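(* Let $f:Y\to X$ be a continuous map of topological spaces, with $X$ and $Y$ paracompact. Let $\mathscr{S}$ and $\mathscr{T}$ be sheaves of abelian groups on $X$ and $Y$, respectively, and $\eta:\mathscr{S}\to f_*\mathscr{T}$ a morphism. Then, for any resolution $(\mathscr{K},\mathscr{L},\varphi)$ of $(\mathscr{S},\mathscr{T},\eta)$ such that $\mathscr{K}$ and $\mathscr{L}$ are soft resolutions (of $\mathscr{S}$ and $\mathscr{T}$), there is a canonical isomorphism $$H^{q}(M^{*}(\varphi))\simeq H^{q}(f;\eta)$$ for every $q$.
   Context: Sheaves are sheaves of abelian groups; complexes of sheaves vanish in negative degrees. Paracompact means Hausdorff and every open covering admits a locally finite refinement. A sheaf $\mathscr{G}$ on a paracompact space is soft if its global sections restrict surjectively onto the sections over every closed subset; a soft resolution is a resolution by soft sheaves. Resolution of a triple: $(\mathscr{K},\mathscr{L},\varphi)$ is a resolution of $(\mathscr{S},\mathscr{T},\eta)$ if $0\to\mathscr{S}\xrightarrow{\imath}\mathscr{K}$ and $0\to\mathscr{T}\xrightarrow{\jmath}\mathscr{L}$ are resolutions on $X$ and $Y$ respectively, and $\varphi:\mathscr{K}\to f_*\mathscr{L}$ is a morphism of complexes with $\varphi\circ\imath=(f_*\jmath)\circ\eta$. Co-mapping cone: $M^*(\varphi)$ is the complex of abelian groups with $M^*(\varphi)^q=\mathscr{K}^q(X)\oplus\mathscr{L}^{q-1}(Y)$ and differential $d(k,\ell)=(dk,\ \varphi k-d\ell)$, where $\varphi:\mathscr{K}^q(X)\to (f_*\mathscr{L}^q)(X)=\mathscr{L}^q(Y)$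 is the induced map. Mapping cylinder: $Z(f)=X\amalg Y$ as a set, with the topology having as basis of open sets the sets $\tilde U=U\amalg f^{-1}(U)$ ($U\subset X$ open) and the open sets $V\subset Y$. Then $X$ is closed and $Y=Z(f)\smallsetminus X$ is open in $Z(f)$. The sheaf $\mathscr{Z}^*(\eta)$ on $Z(f)$ is defined by $\mathscr{Z}^*(\eta)(\tilde U)=\mathscr{S}(U)$ and $\mathscr{Z}^*(\eta)(V)=\mathscr{T}(V)$, the restriction $\mathscr{Z}^*(\eta)(\tilde U)=\mathscr{S}(U)\to\mathscr{Z}^*(\eta)(f^{-1}U)=\mathscr{T}(f^{-1}U)$ being given by $\eta$. Cohomology of $f$ with coefficients in $\eta$: $H^q(f;\eta)=H^q(Z(f),Z(f)\smallsetminus X;\mathscr{Z}^*(\eta))$. Here for a sheaf $\mathscr{A}$ on a space $Z$ and an open set $Z'\subset Z$, $H^q(Z,Z';\mathscr{A})$ is the $q$-th cohomology of the complex of global sections vanishing on $Z'$ of a flabby resolution (e.g. the Godement resolution) of $\mathscr{A}$. *)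

(* Defs.v *)
From HB Require Import structures.
From mathcomp Require Import all_boot all_order all_algebra generic_quotient.
From mathcomp Require Import ring_quotient.
From mathcomp Require Import all_classical topology.

Set Implicit Arguments.
Unset Strict Implicit.
Unset Printing Implicit Defensive.

Import GRing.Theory.
Export Quotient.Exports.
Local Open Scope classical_set_scope.
Local Open Scope ring_scope.
Local Open Scope quotient_scope.

Section Subgroups.
Variable V : zmodType.

Definition subzmod (P : zmodClosed V) : Type := {x : V | x \in P}.
HB.instance Definition _ (P : zmodClosed V) := SubChoice.copy (subzmod P)
  {x : V | x \in P}.
HB.instance Definition _ (P : zmodClosed V) :=
  [SubChoice_isSubZmodule of subzmod P by <:].

Variable W : zmodType.
Definition kerP (u : {additive V -> W}) : {pred V} := [pred x | u x == 0].
Lemma kerP_closed u : zmod_closed (kerP u).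
Proof.
split=> [|x y]; rewrite !inE ?raddf0 // => /eqP ux /eqP uy.
by rewrite raddfB ux uy subrr.
Qed.
HB.instance Definition _ u := GRing.isZmodClosed.Build V (kerP u) (kerP_closed u).

Definition eqzP (u v : {additive V -> W}) : {pred V} := [pred x | u x == v x].
Lemma eqzP_closed u v : zmod_closed (eqzP u v).
Proof.
split=> [|x y]; rewrite !inE ?raddf0 // => /eqP ux /eqP uy.
by rewrite !raddfB ux uy.
Qed.
HB.instance Definition _ u v :=
  GRing.isZmodClosed.Build V (eqzP u v) (eqzP_closed u v).

Definition kernel (u : {additive V -> W}) : zmodType := subzmod (kerP u).
Definition equalizer (u v : {additive V -> W}) : zmodType := subzmod (eqzP u v).

Lemma kernelE (u : {additive V -> W}) (x : kernel u) : u (\val x) = 0.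
Proof. by apply/eqP; exact: (valP x). Qed.

Lemma equalizerE (u v : {additive V -> W}) (x : equalizer u v) :
  u (\val x) = v (\val x).
Proof. by apply/eqP; exact: (valP x). Qed.

Definition mkker (u : {additive V -> W}) x (ux : u x = 0) : kernel u :=
  exist _ x (introT eqP ux).
Definition mkeqz (u v : {additive V -> W}) x (ux : u x = v x) : equalizer u v :=
  exist _ x (introT eqP ux).

End Subgroups.

Record cochain := Cochain {
  cobj :> nat -> zmodType;
  cdiff : forall q, {additive cobj q -> cobj q.+1};
  cdiffK : forall q x, cdiff q.+1 (cdiff q x) = 0 }.

Record cmap (A B : cochain) := CMap {
  cmapf :> forall q, {additive A q -> B q};
  cmap_diff : forall q x, cmapf q.+1 (cdiff A q x) = cdiff B q (cmapf q x) }.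

Section Cohomology.
Variable C : cochain.

Definition cocycle (q : nat) : zmodType := kernel (cdiff C q).

Definition is_coboundary (q : nat) : C q -> Prop :=
  match q return C q -> Prop with
  | 0 => fun x => x = 0
  | q'.+1 => fun x => exists y, cdiff C q' y = x
  end.

Lemma is_coboundary0 q : is_coboundary (0 : C q).
Proof. by case: q => //= q; exists 0; rewrite raddf0. Qed.

Lemma is_coboundaryB q (x y : C q) :
  is_coboundary x -> is_coboundary y -> is_coboundary (x - y).
Proof.
case: q x y => [x y /= -> ->|q x y /= [x' <-] [y' <-]]; first exact: subr0.
by exists (x' - y'); rewrite raddfB.
Qed.

Definition coboundary (q : nat) : {pred cocycle q} :=
  [pred x | `[< is_coboundary (\val x) >]].
Lemma coboundary_closed q : zmod_closed (@coboundary q).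
Proof.
split=> [|x y]; rewrite !inE ?raddf0 ?raddfB; first exact: is_coboundary0.
exact: is_coboundaryB.
Qed.
HB.instance Definition _ q :=
  GRing.isZmodClosed.Build (cocycle q) (@coboundary q) (@coboundary_closed q).

Definition cohomology (q : nat) : zmodType := Quotient.quot (@coboundary q).

Definition cohclass (q : nat) (z : cocycle q) : cohomology q :=
  \pi_(cohomology q) z.

End Cohomology.

Section CohomologyMap.
Variables (A B : cochain) (u : cmap A B) (q : nat).

Lemma cocycle_map_subproof (z : cocycle A q) : cdiff B q (u q (\val z)) = 0.
Proof. by rewrite -cmap_diff kernelE raddf0. Qed.

Definition cocycle_map (z : cocycle A q) : cocycle B q :=
  mkker (cocycle_map_subproof z).

Definition cohom_map (c : cohomology A q) : cohomology B q :=
  cohclass (cocycle_map (repr c)).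

Lemma cohom_map_class z : cohom_map (cohclass z) = cohclass (cocycle_map z).
Proof.
apply/eqP; rewrite /cohom_map /cohclass -Quotient.idealrBE.
have : repr (cohclass z) - z \in @coboundary A q.
  by rewrite Quotient.idealrBE reprK.
rewrite !inE => h.
rewrite raddfB /= -raddfB -[_ - _]/(\val (repr (cohclass z) - z)).
move: (repr _ - z) h => x {z}.
case: (q) (\val x) => [y /= ->|q' y /= [t <-]]; first by rewrite raddf0.
by exists (u q' t); rewrite -cmap_diff.
Qed.

End CohomologyMap.

(** The co-mapping cone of [u : A -> B]: in degree [q] it is
    [A q * B q.-1], where [B] vanishes in degree [-1]. *)
Section Cone.
Variables (A B : cochain) (u : cmap A B).

Definition cone_obj (q : nat) : zmodType :=
  if q is q'.+1 then (A q'.+1 * B q')%type : zmodType else A 0.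

Definition cone_fun (q : nat) : cone_obj q -> cone_obj q.+1 :=
  match q return cone_obj q -> cone_obj q.+1 with
  | 0 => fun a => (cdiff A 0 a, u 0 a)
  | q'.+1 => fun p => (cdiff A q'.+1 p.1, u q'.+1 p.1 - cdiff B q' p.2)
  end.

Lemma cone_fun_additive q : zmod_morphism (@cone_fun q).
Proof.
case: q => [|q] x y /=; first by rewrite !raddfB.
case: x y => [x1 x2] [y1 y2]; rewrite /= !raddfB /=; congr pair.
rewrite -[RHS]/((u q.+1 x1 - cdiff B q x2) - (u q.+1 y1 - cdiff B q y2)).
by rewrite opprK opprB addrACA [- _ + cdiff _ _ _]addrC; congr (_ + _); rewrite addrC.
Qed.
HB.instance Definition _ q := GRing.isZmodMorphism.Build _ _ (@cone_fun q)
  (@cone_fun_additive q).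

Lemma cone_funK q x : @cone_fun q.+1 (@cone_fun q x) = 0.
Proof.
case: q x => [|q] x /=; first by rewrite cdiffK cmap_diff subrr.
by rewrite raddfB /= cdiffK [cdiff B _ (cdiff B _ _)]cdiffK cmap_diff subr0 subrr.
Qed.

Definition cone : cochain := @Cochain cone_obj (fun q => @cone_fun q) cone_funK.

End Cone.

Section ConeMap.
Variables (A B A' B' : cochain) (u : cmap A B) (u' : cmap A' B').
Variables (a : cmap A A') (b : cmap B B').
Hypothesis ab : forall q x, u' q (a q x) = b q (u q x).

Definition cone_map_fun (q : nat) : cone u q -> cone u' q :=
  match q return cone u q -> cone u' q with
  | 0 => a 0
  | q'.+1 => fun p => (a q'.+1 p.1, b q' p.2)
  end.

Lemma cone_map_fun_additive q : zmod_morphism (@cone_map_fun q).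
Proof. by case: q => [|q] x y /=; rewrite !raddfB. Qed.
HB.instance Definition _ q := GRing.isZmodMorphism.Build _ _ (@cone_map_fun q)
  (@cone_map_fun_additive q).

Lemma cone_map_diff q (x : cone u q) :
  cone_map_fun (cdiff (cone u) q x) = cdiff (cone u') q (cone_map_fun x).
Proof.
by case: q x => [|q] x /=; rewrite cmap_diff ?raddfB /= ab ?cmap_diff.
Qed.

Definition cone_map : cmap (cone u) (cone u') :=
  @CMap (cone u) (cone u') (fun q => @cone_map_fun q) cone_map_diff.

End ConeMap.

(** [kercochain u] is the subcomplex [ker u] of [A]; it maps to the cone of
    [u] by [a |-> (a, 0)]. *)
Section KernelComplex.
Variables (A B : cochain) (u : cmap A B).

Lemma ker_diff_subproof q (x : kernel (u q)) : u q.+1 (cdiff A q (\val x)) = 0.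
Proof. by rewrite cmap_diff kernelE raddf0. Qed.

Definition ker_diff q (x : kernel (u q)) : kernel (u q.+1) :=
  mkker (ker_diff_subproof x).
Lemma ker_diff_additive q : zmod_morphism (@ker_diff q).
Proof. by move=> x y; apply: val_inj; rewrite /= !raddfB. Qed.
HB.instance Definition _ q := GRing.isZmodMorphism.Build _ _ (@ker_diff q)
  (@ker_diff_additive q).

Lemma ker_diffK q x : @ker_diff q.+1 (@ker_diff q x) = 0.
Proof. by apply: val_inj; rewrite /= cdiffK. Qed.

Definition kercochain : cochain := 
  @Cochain (fun q => kernel (u q)) (fun q => @ker_diff q) ker_diffK.

Definition ker_to_cone_fun (q : nat) : kercochain q -> cone u q :=
  match q return kercochain q -> cone u q with
  | 0 => fun x => \val x
  | q'.+1 => fun x => (\val x, 0)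
  end.
Lemma ker_to_cone_fun_additive q : zmod_morphism (@ker_to_cone_fun q).
Proof.
case: q => [|q] x y; first exact: (raddfB \val).
exact: (congr2 pair (raddfB \val x y) (esym (subr0 _))).
Qed.
HB.instance Definition _ q := GRing.isZmodMorphism.Build _ _
  (@ker_to_cone_fun q) (@ker_to_cone_fun_additive q).

Lemma ker_to_cone_diff q (x : kercochain q) :
  ker_to_cone_fun (cdiff kercochain q x) = cdiff (cone u) q (ker_to_cone_fun x).
Proof.
case: q x => [|q] x; first exact: (congr2 pair erefl (esym (kernelE x))).
by apply: (congr2 pair) => //=; rewrite raddf0 subr0; exact: (esym (kernelE x)).
Qed.

Definition ker_to_cone : cmap kercochain (cone u) :=
  @CMap kercochain (cone u) (fun q => @ker_to_cone_fun q) ker_to_cone_diff.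

End KernelComplex.

Section KernelComplexMap.
Variables (A B A' B' : cochain) (u : cmap A B) (u' : cmap A' B').
Variables (a : cmap A A') (b : cmap B B').
Hypothesis ab : forall q x, u' q (a q x) = b q (u q x).

Lemma kercochain_map_subproof q (x : kernel (u q)) : u' q (a q (\val x)) = 0.
Proof. by rewrite ab kernelE raddf0. Qed.

Definition kercochain_map_fun q (x : kercochain u q) : kercochain u' q :=
  mkker (kercochain_map_subproof x).
Lemma kercochain_map_fun_additive q : zmod_morphism (@kercochain_map_fun q).
Proof. by move=> x y; apply: val_inj; rewrite /= !raddfB. Qed.
HB.instance Definition _ q := GRing.isZmodMorphism.Build _ _
  (@kercochain_map_fun q) (@kercochain_map_fun_additive q).

Lemma kercochain_map_diff q (x : kercochain u q) :
  kercochain_map_fun (cdiff _ q x) = cdiff _ q (kercochain_map_fun x).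
Proof. by apply: val_inj; rewrite /= cmap_diff. Qed.

Definition kercochain_map : cmap (kercochain u) (kercochain u') :=
  @CMap (kercochain u) (kercochain u') (fun q => @kercochain_map_fun q) kercochain_map_diff.

End KernelComplexMap.

Definition paracompact (X : topologicalType) : Prop :=
  hausdorff_space X /\
  forall C : set (set X),
    (forall U, C U -> open U) -> \bigcup_(U in C) U = setT ->
    exists D : set (set X),
      [/\ forall V, D V -> open V,
          \bigcup_(V in D) V = setT,
          forall V, D V -> exists2 U, C U & V `<=` U &
          forall x : X, exists2 N, nbhs x N &
            finite_set [set V | D V /\ V `&` N !=set0]].

Record opens (X : topologicalType) := Opens {
  oset :> set X;
  oset_open : open oset }.

Definition opensT (X : topologicalType) : opens X := Opens openT.

Lemma sub_opensT (X : topologicalType) (U : opens X) : U `<=` opensT X.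
Proof. by []. Qed.
Arguments sub_opensT {X} U.

Definition opre (X Y : topologicalType) (f : continuousType Y X) (U : opens X) :
    opens Y :=
  Opens (open_comp (fun y _ => cts_fun y) (oset_open U) : open (f @^-1` U)).

Record sheaf (X : topologicalType) := Sheaf {
  sec :> opens X -> zmodType;
  res : forall U V : opens X, V `<=` U -> {additive sec U -> sec V};
  res_id : forall (U : opens X) (h : U `<=` U) s, res h s = s;
  res_comp : forall (U V W : opens X) (h1 : V `<=` U) (h2 : W `<=` V) (h : W `<=` U) s,
    res h2 (res h1 s) = res h s;
  sheaf_locality : forall (U : opens X) (I : Type) (C : I -> opens X)
    (hC : forall i, C i `<=` U), U `<=` \bigcup_i C i ->
    forall s t : sec U, (forall i, res (hC i) s = res (hC i) t) -> s = t;
  sheaf_gluing : forall (U : opens X) (I : Type) (C : I -> opens X)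
    (hC : forall i, C i `<=` U), U `<=` \bigcup_i C i ->
    forall s : forall i, sec (C i),
    (forall i j (W : opens X) (hi : W `<=` C i) (hj : W `<=` C j),
       res hi (s i) = res hj (s j)) ->
    exists t : sec U, forall i, res (hC i) t = s i }.
Arguments res {X} _ {U V} h.

Definition gsec (X : topologicalType) (A : sheaf X) : zmodType := A (opensT X).

Record shom (X : topologicalType) (A B : sheaf X) := SHom {
  shomf :> forall U, {additive A U -> B U};
  shom_res : forall (U V : opens X) (h : V `<=` U) s, shomf V (res A h s) = res B h (shomf U s) }.

Section Pushforward.
Variables (X Y : topologicalType) (f : continuousType Y X) (T : sheaf Y).

Definition opre_sub (U V : opens X) (h : V `<=` U) : opre f V `<=` opre f U :=
  fun y => h (f y).

Definition pushforward : sheaf X.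
Proof.
apply: (@Sheaf X (fun U => T (opre f U)) (fun U V h => res T (opre_sub h))).
- by move=> *; apply: res_id.
- by move=> *; apply: res_comp.
- move=> U I C hC cov s t; apply: sheaf_locality => y /cov [i _ Ci].
  by exists i.
- move=> U I C hC cov s sC.
  have cov' : opre f U `<=` \bigcup_i opre f (C i).
    by move=> y /cov [i _ Ci]; exists i.
  apply: (sheaf_gluing (fun i => opre_sub (hC i)) cov') => i j W hi hj.
  pose Cij := Opens (openI (oset_open (C i)) (oset_open (C j))).
  have hCi : Cij `<=` C i by move=> x [].
  have hCj : Cij `<=` C j by move=> x [].
  have hW : W `<=` opre f Cij by move=> y Wy; split; [exact: hi|exact: hj].
  rewrite -(res_comp (opre_sub hCi) hW) -(res_comp (opre_sub hCj) hW).
  by rewrite (sC i j Cij hCi hCj).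
Defined.

End Pushforward.

Section Softness.
Variables (X : topologicalType) (G : sheaf X).

(** The germ of [s] at [x], as an equivalence class of local sections. *)
Definition germ (U : opens X) (s : G U) (x : X) : set {V : opens X & G V} :=
  [set p : {V : opens X & G V} | exists (W : opens X) (hU : W `<=` U) (hV : W `<=` projT1 p),
     oset W x /\ res G hU s = res G hV (projT2 p)].

(** Sections over an arbitrary subset [A], i.e. of the inverse image of [G]
    on [A]: families of germs that are locally induced by sections of [G]. *)
Definition section_on (A : set X) (sigma : X -> set {V : opens X & G V}) :=
  forall x, A x -> exists (U : opens X) (s : G U),
    oset U x /\ forall z, A z -> oset U z -> sigma z = germ s z.

Definition soft : Prop :=
  forall A : set X, closed A -> forall sigma, section_on A sigma ->
  exists s : gsec G, forall x, A x -> sigma x = germ s x.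

Definition flabby : Prop :=
  forall (U : opens X) (s : G U),
  exists t : gsec G, res G (sub_opensT U) t = s.

End Softness.

Section ExactAt.
Variables (X : topologicalType) (A B C : sheaf X).

Definition sheaf_mono (u : shom A B) : Prop :=
  forall U, injective (u U).

(** The sections of the image sheaf are those locally in the image of [u]. *)
Definition exact_at (u : shom A B) (v : shom B C) : Prop :=
  forall (U : opens X) (s : B U),
    v U s = 0 <->
    forall x, oset U x -> exists (V : opens X) (h : V `<=` U) (t : A V),
      oset V x /\ u V t = res B h s.

End ExactAt.

Record augcplx (X : topologicalType) (A : sheaf X) := AugCplx {
  shobj :> nat -> sheaf X;
  aug : shom A (shobj 0);
  shdiff : forall q, shom (shobj q) (shobj q.+1);
  aug_diff : forall U s, shdiff 0 U (aug U s) = 0;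
  shdiffK : forall q U s, shdiff q.+1 U (shdiff q U s) = 0 }.

Definition is_resolution (X : topologicalType) (A : sheaf X) (K : augcplx A) :=
  [/\ sheaf_mono (aug K), exact_at (aug K) (shdiff K 0) &
      forall q, exact_at (shdiff K q) (shdiff K q.+1)].

Record augmap (X : topologicalType) (A : sheaf X) (K L : augcplx A) := AugMap {
  augmapf :> forall q, shom (K q) (L q);
  augmap_aug : forall U s, augmapf 0 U (aug K U s) = aug L U s;
  augmap_diff : forall q U s,
    augmapf q.+1 U (shdiff K q U s) = shdiff L q U (augmapf q U s) }.

Section SectionComplexes.
Variables (X : topologicalType) (A : sheaf X).

Definition seccplx (K : augcplx A) (U : opens X) : cochain :=
  Cochain (cobj := fun q => K q U) (cdiff := fun q => shdiff K q U)
    (fun q s => shdiffK s).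

Definition seccplx_res (K : augcplx A) (U V : opens X) (h : V `<=` U) :
    cmap (seccplx K U) (seccplx K V) :=
  @CMap (seccplx K U) (seccplx K V) (fun q => res (K q) h)
    (fun q s => esym (shom_res (shdiff K q) h s)).

Definition seccplx_map (K L : augcplx A) (g : augmap K L) (U : opens X) :
    cmap (seccplx K U) (seccplx L U) :=
  @CMap (seccplx K U) (seccplx L U) (fun q => g q U) (fun q s => augmap_diff g s).

Definition gres (K : augcplx A) (U : opens X) :
    cmap (seccplx K (opensT X)) (seccplx K U) :=
  seccplx_res K (sub_opensT U).

Definition relcplx (K : augcplx A) (U : opens X) : cochain := kercochain (gres K U).

Lemma seccplx_map_gres (K L : augcplx A) (g : augmap K L) (U : opens X) q s :
  gres L U q (seccplx_map g (opensT X) q s) = seccplx_map g U q (gres K U q s).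
Proof. by rewrite /= shom_res. Qed.

Definition relcplx_map (K L : augcplx A) (g : augmap K L) (U : opens X) :
    cmap (relcplx K U) (relcplx L U) :=
  kercochain_map (@seccplx_map_gres K L g U).

Definition relcone (K : augcplx A) (U : opens X) : cochain := cone (gres K U).

Definition relcone_map (K L : augcplx A) (g : augmap K L) (U : opens X) :
    cmap (relcone K U) (relcone L U) :=
  cone_map (@seccplx_map_gres K L g U).

Record flabby_resolution := FlabbyResolution {
  flabby_cplx :> augcplx A;
  flabby_is_resolution : is_resolution flabby_cplx;
  flabby_cplx_flabby : forall q, flabby (flabby_cplx q) }.

(** [H^q(X, U; A)] *)
Definition relcohomology (F : flabby_resolution) (U : opens X) (q : nat) : zmodType :=
  cohomology (relcplx F U) q.

End SectionComplexes.

(** [f] is a parameter because the topology depends on it. *)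
Definition cylinder (X Y : topologicalType) (f : continuousType Y X) : Type :=
  (X + Y)%type.
HB.instance Definition _ X Y f := Choice.copy (@cylinder X Y f) (X + Y)%type.

Section Cylinder.
Variables (X Y : topologicalType) (f : continuousType Y X).

Local Notation Zf := (cylinder f).

Definition cinl (x : X) : Zf := inl x.
Definition cinr (y : Y) : Zf := inr y.

Definition tilde (U : set X) : set Zf := cinl @` U `|` cinr @` (f @^-1` U).

Definition cyl_basis : set (set Zf) :=
  [set tilde U | U in open] `|` [set cinr @` V | V in open].

Lemma tilde_inl U x : tilde U (cinl x) <-> U x.
Proof. by split=> [[[x' Ux' [<-]]|[y _ //]]|Ux]; last by left; exists x. Qed.
Lemma tilde_inr U y : tilde U (cinr y) <-> U (f y).
Proof. by split=> [[[x _ //]|[y' Uy' [<-]]]|Ux]; last by right; exists y. Qed.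
Lemma im_inr V y : (cinr @` V) (cinr y) <-> V y.
Proof. by split=> [[y' Vy' [<-]]|Vy]; last by exists y. Qed.
Lemma im_inr_inl V x : ~ (cinr @` V) (cinl x).
Proof. by case. Qed.

Lemma cyl_basis_cover : \bigcup_(W in cyl_basis) W = setT.
Proof.
rewrite -subTset => z _; exists (tilde setT); first by left; exists setT => //; exact: openT.
by case: z => [x|y]; [apply/tilde_inl|apply/tilde_inr].
Qed.

Lemma cyl_basis_join (A B : set Zf) (z : Zf) :
  cyl_basis A -> cyl_basis B -> A z -> B z ->
  exists C, [/\ cyl_basis C, C z & C `<=` A `&` B].
Proof.
have fo U : open U -> open (f @^-1` U).
  by apply: open_comp => y _; exact: cts_fun.
move=> [[U oU <-]|[U oU <-]] [[V oV <-]|[V oV <-]].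
- case: z => [x /tilde_inl Ux /tilde_inl Vx|y /tilde_inr Ux /tilde_inr Vx].
    exists (tilde (U `&` V)); split; first by left; exists (U `&` V) => //; exact: openI.
      exact/tilde_inl.
    by case=> [x'|y'] => [/tilde_inl[? ?]|/tilde_inr[? ?]]; split;
      (exact/tilde_inl || exact/tilde_inr).
  exists (tilde (U `&` V)); split; first by left; exists (U `&` V) => //; exact: openI.
    exact/tilde_inr.
  by case=> [x'|y'] => [/tilde_inl[? ?]|/tilde_inr[? ?]]; split;
    (exact/tilde_inl || exact/tilde_inr).
- case: z => [x _ /im_inr_inl//|y /tilde_inr Ux /im_inr Vx].
  exists (cinr @` (f @^-1` U `&` V)); split.
  + by right; exists (f @^-1` U `&` V) => //; apply: openI => //; exact: fo.
  + exact/im_inr.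
  + by move=> _ [y' [? ?] <-]; split; [exact/tilde_inr|exact/im_inr].
- case: z => [x /im_inr_inl//|y /im_inr Vx /tilde_inr Ux].
  exists (cinr @` (U `&` f @^-1` V)); split.
  + by right; exists (U `&` f @^-1` V) => //; apply: openI => //; exact: fo.
  + exact/im_inr.
  + by move=> _ [y' [? ?] <-]; split; [exact/im_inr|exact/tilde_inr].
- case: z => [x /im_inr_inl//|y /im_inr Ux /im_inr Vx].
  exists (cinr @` (U `&` V)); split.
  + by right; exists (U `&` V) => //; exact: openI.
  + exact/im_inr.
  + by move=> _ [y' [? ?] <-]; split; exact/im_inr.
Qed.

HB.instance Definition _ := isBaseTopological.Build Zf
  (I := set Zf) (D := cyl_basis) (b := id) cyl_basis_cover cyl_basis_join.

Lemma cyl_open_basis (W : set Zf) : cyl_basis W -> open W.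
Proof.
move=> bW; exists [set W]; first by move=> ? ->.
by rewrite bigcup_set1.
Qed.

Lemma cyl_openP (W : set Zf) :
  open W <->
  [/\ open (cinl @^-1` W), open (cinr @^-1` W) &
      f @^-1` (cinl @^-1` W) `<=` cinr @^-1` W].
Proof.
have fo U : open U -> open (f @^-1` U).
  by apply: open_comp => y _; exact: cts_fun.
split=> [[D sD <-]|[oX oY sXY]].
  have tl U : cinl @^-1` tilde U = U.
    by apply/seteqP; split=> x /tilde_inl.
  have tr U : cinr @^-1` tilde U = f @^-1` U.
    by apply/seteqP; split=> x /tilde_inr.
  have il V : cinl @^-1` (cinr @` V) = set0.
    by apply/seteqP; split=> x // /im_inr_inl.
  have ir V : cinr @^-1` (cinr @` V) = V.
    by apply/seteqP; split=> x /im_inr.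
  split.
  - rewrite preimage_bigcup; apply: bigcup_open => B /sD [[U oU <-]|[V oV <-]].
      by rewrite /= tl.
    by rewrite /= il; exact: open0.
  - rewrite preimage_bigcup; apply: bigcup_open => B /sD [[U oU <-]|[V oV <-]].
      by rewrite /= tr; exact: fo.
    by rewrite /= ir.
  - move=> y [B DB]; move: (sD _ DB) (DB) => [[U oU <-]|[V oV <-]] {}DB.
      by move=> /tilde_inl Uy; exists (tilde U); [|exact: (tilde_inr U y).2].
    by move=> /im_inr_inl.
have -> : W = tilde (cinl @^-1` W) `|` cinr @` (cinr @^-1` W).
  apply/seteqP; split; first case=> [x|y] Wz.
  - by left; apply/tilde_inl.
  - by right; apply/im_inr.
  case=> [x|y]; first by case=> [/tilde_inl|/im_inr_inl].
  by case=> [/tilde_inr Uy|/im_inr //]; exact: sXY.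
apply: openU; apply: cyl_open_basis.
  by left; exists (cinl @^-1` W).
by right; exists (cinr @^-1` W).
Qed.

Definition cylX (W : opens Zf) : opens X :=
  Opens (let: And3 o _ _ := (cyl_openP W).1 (oset_open W) in o).
Definition cylY (W : opens Zf) : opens Y :=
  Opens (let: And3 _ o _ := (cyl_openP W).1 (oset_open W) in o).
Lemma cylXY (W : opens Zf) : opre f (cylX W) `<=` cylY W.
Proof. by have [_ _] := (cyl_openP W).1 (oset_open W). Qed.

Lemma cylX_sub (V W : opens Zf) (h : V `<=` W) : cylX V `<=` cylX W.
Proof. by move=> x; exact: h. Qed.
Lemma cylY_sub (V W : opens Zf) (h : V `<=` W) : cylY V `<=` cylY W.
Proof. by move=> y; exact: h. Qed.

Lemma cyl_compl_open : open (~` range cinl).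
Proof.
apply: cyl_open_basis; right; exists setT; first exact: openT.
apply/seteqP; split; first by move=> _ [y _ <-] [].
by case=> [x []|y _]; [exists x|exists y].
Qed.

Definition cyl_compl : opens Zf := Opens cyl_compl_open.

End Cylinder.

Arguments cylXY {X Y f} W.
Arguments cylX {X Y f} W.
Arguments cylY {X Y f} W.
Arguments opre {X Y} f U.

(** An open set [W] of [Z(f)] is the union of the basic open sets
    [tilde (cylX W)] and [cylY W], whose intersection is the preimage of
    [cylX W]. So the sheaf condition forces the sections of [Z^*(eta)] over [W]
    to be the pairs in [S (cylX W) * T (cylY W)] that agree through [eta]. The
    values and the restriction prescribed on the basis are recovered in
    [Zstar_tilde_bij], [Zstar_inr_bij] and [Zstar_tilde_res]. *)
Section Zstar.
Variables (X Y : topologicalType) (f : continuousType Y X).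
Variables (S : sheaf X) (T : sheaf Y) (eta : shom S (pushforward f T)).

Definition Zsec (W : opens (cylinder f)) : zmodType :=
  @equalizer (S (cylX W) * T (cylY W))%type (T (opre f (cylX W)))
    (eta (cylX W) \o fst) (res T (cylXY W) \o snd).

Lemma ZsecP W (s : Zsec W) :
  eta (cylX W) (\val s).1 = res T (cylXY W) (\val s).2.
Proof. by apply/eqP; exact: (valP s). Qed.

Section Res.
Variables (U V : opens (cylinder f)) (h : V `<=` U).

Lemma Zres_subproof (s : Zsec U) :
  eta (cylX V) (res S (cylX_sub h) (\val s).1) =
  res T (cylXY V) (res T (cylY_sub h) (\val s).2).
Proof.
rewrite shom_res ZsecP /=.
have h' : opre f (cylX V) `<=` cylY U by move=> y /cylXY; exact: h.
by rewrite !(res_comp _ _ h').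
Qed.

Definition Zres_fun (s : Zsec U) : Zsec V :=
  @mkeqz _ _ (eta (cylX V) \o fst) (res T (cylXY V) \o snd)
    (res S (cylX_sub h) (\val s).1, res T (cylY_sub h) (\val s).2)
    (Zres_subproof s).
Lemma Zres_fun_additive : zmod_morphism Zres_fun.
Proof. by move=> s t; apply: val_inj; congr pair; rewrite /= !raddfB. Qed.
HB.instance Definition _ := GRing.isZmodMorphism.Build _ _ Zres_fun
  Zres_fun_additive.
End Res.

Definition Zstar : sheaf (cylinder f).
Proof.
apply: (@Sheaf _ Zsec (fun U V h => @Zres_fun U V h)).
- move=> U h s; apply: val_inj => /=.
  by rewrite !res_id; case: (\val s).
- by move=> U V W h1 h2 h s; apply: val_inj; congr pair; exact: res_comp.
- move=> U I C hC cov s t st; apply: val_inj.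
  have covX : cylX U `<=` \bigcup_i cylX (C i).
    by move=> x /cov [i _ Ci]; exists i.
  have covY : cylY U `<=` \bigcup_i cylY (C i).
    by move=> x /cov [i _ Ci]; exists i.
  rewrite [LHS]surjective_pairing [RHS]surjective_pairing; congr pair.
    apply: (@sheaf_locality _ S _ _ _ (fun i => cylX_sub (hC i)) covX) => i.
    by have /(congr1 (fun z => (\val z).1)) := st i.
  apply: (@sheaf_locality _ T _ _ _ (fun i => cylY_sub (hC i)) covY) => i.
  by have /(congr1 (fun z => (\val z).2)) := st i.
- move=> U I C hC cov s sC.
  have covX : cylX U `<=` \bigcup_i cylX (C i).
    by move=> x /cov [i _ Ci]; exists i.
  have covY : cylY U `<=` \bigcup_i cylY (C i).
    by move=> x /cov [i _ Ci]; exists i.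
  pose Cij i j := Opens (openI (oset_open (C i)) (oset_open (C j))).
  have hCi i j : Cij i j `<=` C i by move=> x [].
  have hCj i j : Cij i j `<=` C j by move=> x [].
  have [a aE] : exists a : S (cylX U), forall i,
      res S (cylX_sub (hC i)) a = (\val (s i)).1.
    apply: (@sheaf_gluing _ S _ _ _ (fun i => cylX_sub (hC i)) covX) => i j W hi hj.
    have hW : W `<=` cylX (Cij i j).
      by move=> x Wx; split; [exact: hi|exact: hj].
    rewrite -(res_comp (cylX_sub (hCi i j)) hW) -(res_comp (cylX_sub (hCj i j)) hW).
    by have /(congr1 (fun z => (\val z).1))/= -> := sC i j _ (hCi i j) (hCj i j).
  have [b bE] : exists b : T (cylY U), forall i,
      res T (cylY_sub (hC i)) b = (\val (s i)).2.
    apply: (@sheaf_gluing _ T _ _ _ (fun i => cylY_sub (hC i)) covY) => i j W hi hj.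
    have hW : W `<=` cylY (Cij i j).
      by move=> x Wx; split; [exact: hi|exact: hj].
    rewrite -(res_comp (cylY_sub (hCi i j)) hW) -(res_comp (cylY_sub (hCj i j)) hW).
    by have /(congr1 (fun z => (\val z).2))/= -> := sC i j _ (hCi i j) (hCj i j).
  have ab : eta (cylX U) a = res T (cylXY U) b.
    have cov' : opre f (cylX U) `<=` \bigcup_i opre f (cylX (C i)).
      by move=> y /cov [i _ Ci]; exists i.
    have h' i : opre f (cylX (C i)) `<=` cylY U by move=> y /cylXY; exact: hC.
    apply: (@sheaf_locality _ T _ _ _ (fun i => @opre_sub _ _ f _ _ (cylX_sub (hC i))) cov') => i.
    rewrite (res_comp _ _ (h' i)) -(res_comp (cylY_sub (hC i)) (cylXY _)).
    by rewrite bE -ZsecP -aE shom_res.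
  exists (@mkeqz _ _ (eta (cylX U) \o fst) (res T (cylXY U) \o snd) (a, b) ab).
  by move=> i; apply: val_inj; rewrite /= aE bE -surjective_pairing.
Defined.

End Zstar.

Section SheafFacts.
Variables (X : topologicalType) (A : sheaf X).

Lemma res_irrel (U V : opens X) (h h' : V `<=` U) (s : A U) : res A h s = res A h' s.
Proof. by rewrite -(res_comp h (@subset_refl _ V) h') res_id. Qed.

Lemma res_bij (U V : opens X) (h : V `<=` U) : U `<=` V -> bijective (res A h).
Proof.
by move=> h'; exists (res A h') => s; rewrite (res_comp _ _ (@subset_refl _ _)) res_id.
Qed.

Lemma sec_empty (U : opens X) : (U : set X) `<=` set0 -> forall s t : A U, s = t.
Proof.
move=> U0 s t; apply: (@sheaf_locality _ A U void (fun=> opensT X)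
  (fun i : void => match i with end)) => [x /U0 //|[]].
Qed.

End SheafFacts.

Section ZstarFacts.
Variables (X Y : topologicalType) (f : continuousType Y X).

Lemma tilde_open (U : opens X) : open (tilde U : set (cylinder f)).
Proof. by apply: cyl_open_basis; left; exists U => //; exact: oset_open. Qed.
Definition opens_tilde (U : opens X) : opens (cylinder f) := Opens (tilde_open U).

Lemma inr_open (V : opens Y) : open (@cinr _ _ f @` V).
Proof. by apply: cyl_open_basis; right; exists V => //; exact: oset_open. Qed.
Definition opens_inr (V : opens Y) : opens (cylinder f) := Opens (inr_open V).

Lemma sub_tildeX (U : opens X) : U `<=` cylX (opens_tilde U).
Proof. by move=> x Ux; apply/tilde_inl. Qed.
Lemma sub_tildeY (U : opens X) : opre f U `<=` cylY (opens_tilde U).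
Proof. by move=> x Ux; apply/tilde_inr. Qed.
Lemma sub_inrY (V : opens Y) : V `<=` cylY (opens_inr V).
Proof. by move=> y Vy; apply/im_inr. Qed.
Lemma sub_inr_tilde (U : opens X) : opens_inr (opre f U) `<=` opens_tilde U.
Proof. by move=> _ [y Uy <-]; right; exists y. Qed.

Variables (S : sheaf X) (T : sheaf Y) (eta : shom S (pushforward f T)).

Definition Zstar_tilde (U : opens X) (s : Zstar eta (opens_tilde U)) : S U :=
  res S (@sub_tildeX U) (\val s).1.

Definition Zstar_inr (V : opens Y) (s : Zstar eta (opens_inr V)) : T V :=
  res T (@sub_inrY V) (\val s).2.

Lemma Zstar_tilde_res (U : opens X) (s : Zstar eta (opens_tilde U)) :
  Zstar_inr (res (Zstar eta) (@sub_inr_tilde U) s) = eta U (Zstar_tilde s).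
Proof.
rewrite /Zstar_inr /Zstar_tilde shom_res ZsecP /= (res_comp _ _ (@sub_tildeY U)).
by rewrite (res_comp _ _ (@sub_tildeY U)).
Qed.

Lemma Zstar_tilde_bij (U : opens X) : bijective (@Zstar_tilde U).
Proof.
have hX : cylX (opens_tilde U) `<=` U by move=> x /tilde_inl.
have hY : cylY (opens_tilde U) `<=` opre f (cylX (opens_tilde U)).
  by move=> y /tilde_inr Uy; apply/tilde_inl.
pose W := opens_tilde U.
have gP (s : S U) : eta (cylX W) (res S hX s) =
    res T (cylXY W) (res T hY (eta (cylX W) (res S hX s))).
  by rewrite (res_comp _ _ (@subset_refl _ _)) res_id.
exists (fun s => @mkeqz _ _ (eta (cylX W) \o fst) (res T (cylXY W) \o snd)
  (res S hX s, res T hY (eta (cylX W) (res S hX s))) (gP s)).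
  move=> s; apply: val_inj; rewrite /= /Zstar_tilde.
  rewrite (res_comp _ _ (@subset_refl _ _)) res_id ZsecP.
  by rewrite (res_comp _ _ (@subset_refl _ _)) res_id -surjective_pairing.
by move=> s; rewrite /Zstar_tilde /= (res_comp _ _ (@subset_refl _ _)) res_id.
Qed.

Lemma Zstar_inr_bij (V : opens Y) : bijective (@Zstar_inr V).
Proof.
have hY : cylY (opens_inr V) `<=` V by move=> y /im_inr.
have h0 : cylX (opens_inr V) `<=` set0 by move=> x /im_inr_inl.
have h0' : opre f (cylX (opens_inr V)) `<=` set0 by move=> y /h0.
pose W := opens_inr V.
have gP (t : T V) : eta (cylX W) 0 = res T (cylXY W) (res T hY t).
  exact: (@sec_empty _ T (opre f (cylX W))).
exists (fun t => @mkeqz _ _ (eta (cylX W) \o fst) (res T (cylXY W) \o snd)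
  (0, res T hY t) (gP t)).
  move=> s; apply: val_inj; rewrite /= /Zstar_inr.
  rewrite (res_comp _ _ (@subset_refl _ _)) res_id.
  by rewrite [RHS]surjective_pairing; congr pair; exact: (@sec_empty _ S (cylX W)).
by move=> s; rewrite /Zstar_inr /= (res_comp _ _ (@subset_refl _ _)) res_id.
Qed.

Variables (S' : sheaf X) (T' : sheaf Y) (eta' : shom S' (pushforward f T')).
Variables (a : shom S S') (b : shom T T').
Hypothesis ab : forall U s, eta' U (a U s) = b (opre f U) (eta U s).

Section At.
Variable W : opens (cylinder f).

Lemma Zstar_map_subproof (s : Zsec eta W) :
  eta' (cylX W) (a _ (\val s).1) = res T' (cylXY W) (b _ (\val s).2).
Proof. by rewrite ab ZsecP shom_res. Qed.

Definition Zstar_map_fun (s : Zsec eta W) : Zsec eta' W :=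
  @mkeqz _ _ (eta' (cylX W) \o fst) (res T' (cylXY W) \o snd)
    (a _ (\val s).1, b _ (\val s).2) (Zstar_map_subproof s).
Lemma Zstar_map_fun_additive : zmod_morphism Zstar_map_fun.
Proof. by move=> s t; apply: val_inj; congr pair; rewrite /= !raddfB. Qed.
HB.instance Definition _ := GRing.isZmodMorphism.Build _ _ Zstar_map_fun
  Zstar_map_fun_additive.
End At.

Lemma Zstar_map_res (U V : opens (cylinder f)) (h : V `<=` U) s :
  Zstar_map_fun (res (Zstar eta) h s) = res (Zstar eta') h (Zstar_map_fun s).
Proof. by apply: val_inj; rewrite /= !shom_res. Qed.

Definition Zstar_map : shom (Zstar eta) (Zstar eta') :=
  @SHom _ (Zstar eta) (Zstar eta') (fun W => @Zstar_map_fun W) Zstar_map_res.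

End ZstarFacts.

Section Triple.
Variables (X Y : topologicalType) (f : continuousType Y X).
Variables (S : sheaf X) (T : sheaf Y) (eta : shom S (pushforward f T)).

Record triple_resolution := TripleResolution {
  tK : augcplx S;
  tL : augcplx T;
  tphi : forall q, shom (tK q) (pushforward f (tL q));
  tphi_diff : forall q U s,
    tphi q.+1 U (shdiff tK q U s) = shdiff tL q (opre f U) (tphi q U s);
  tphi_aug : forall U s, tphi 0 U (aug tK U s) = aug tL (opre f U) (eta U s);
  tK_resolution : is_resolution tK;
  tL_resolution : is_resolution tL }.

(** [H^q(f; eta) = H^q(Z(f), Z(f) \ X; Z^*(eta))] *)
Definition map_cohomology (F : flabby_resolution (Zstar eta)) (q : nat) : zmodType :=
  relcohomology F (cyl_compl f) q.

Variable R : triple_resolution.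

Lemma sub_opre_opensT : opensT Y `<=` opre f (opensT X).
Proof. by []. Qed.

Definition gphi_fun q : {additive gsec (tK R q) -> gsec (tL R q)} :=
  res (tL R q) sub_opre_opensT \o tphi R q (opensT X).

Lemma gphi_diff q (k : seccplx (tK R) (opensT X) q) :
  gphi_fun q.+1 (shdiff (tK R) q _ k) = shdiff (tL R) q _ (gphi_fun q k).
Proof. by rewrite /= tphi_diff shom_res. Qed.

Definition gphi : cmap (seccplx (tK R) (opensT X)) (seccplx (tL R) (opensT Y)) :=
  @CMap (seccplx (tK R) (opensT X)) (seccplx (tL R) (opensT Y)) gphi_fun gphi_diff.

Definition comapping_cone : cochain := cone gphi.

Lemma Zphi_aug_diff U s :
  Zstar_map (@tphi_diff R 0) U (Zstar_map (@tphi_aug R) U s) = 0.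
Proof. by apply: val_inj; rewrite /= !aug_diff. Qed.

Lemma Zphi_diffK q U s :
  Zstar_map (@tphi_diff R q.+1) U (Zstar_map (@tphi_diff R q) U s) = 0.
Proof. by apply: val_inj; rewrite /= !shdiffK. Qed.

Definition Zphi : augcplx (Zstar eta) :=
  @AugCplx _ (Zstar eta) (fun q => Zstar (tphi R q)) (Zstar_map (@tphi_aug R))
    (fun q => Zstar_map (@tphi_diff R q)) Zphi_aug_diff Zphi_diffK.

Lemma cylX_T : cylX (opensT (cylinder f)) `<=` opensT X. Proof. by []. Qed.
Lemma cylY_T : cylY (opensT (cylinder f)) `<=` opensT Y. Proof. by []. Qed.
Lemma cylY_compl : cylY (cyl_compl f) `<=` opensT Y. Proof. by []. Qed.
Lemma cylX_compl0 : cylX (cyl_compl f) `<=` set0.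
Proof. by move=> x; apply; exists x. Qed.

Section At.
Variable q : nat.

Lemma Zphi_glob_subproof (k : gsec (tK R q)) :
  tphi R q _ (res (tK R q) cylX_T k) =
  res (tL R q) (cylXY (opensT (cylinder f))) (res (tL R q) cylY_T (gphi q k)).
Proof.
have h : opre f (cylX (opensT (cylinder f))) `<=` opre f (opensT X) by [].
rewrite shom_res; transitivity (res (tL R q) h (tphi R q _ k)); first exact: (@res_irrel _ (tL R q)).
have h' : opre f (cylX (opensT (cylinder f))) `<=` opensT Y by [].
rewrite (res_comp _ _ h') /= (@res_comp _ (tL R q) _ _ _ sub_opre_opensT h' h) //.
Qed.

Definition Zphi_glob_fun (k : gsec (tK R q)) : gsec (Zphi q) :=
  @mkeqz _ _ (tphi R q _ \o fst) (res (tL R q) (cylXY _) \o snd)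
    (res (tK R q) cylX_T k, res (tL R q) cylY_T (gphi q k)) (Zphi_glob_subproof k).
Lemma Zphi_glob_additive : zmod_morphism Zphi_glob_fun.
Proof. by move=> s t; apply: val_inj; congr pair; rewrite /= !raddfB. Qed.
HB.instance Definition _ := GRing.isZmodMorphism.Build _ _ Zphi_glob_fun
  Zphi_glob_additive.

Lemma Zphi_compl_subproof (l : gsec (tL R q)) :
  tphi R q (cylX (cyl_compl f)) 0 =
  res (tL R q) (cylXY (cyl_compl f)) (res (tL R q) cylY_compl l).
Proof.
by apply: (@sec_empty _ (tL R q) (opre f (cylX (cyl_compl f)))) => y /cylX_compl0.
Qed.

Definition Zphi_compl_fun (l : gsec (tL R q)) : Zphi q (cyl_compl f) :=
  @mkeqz _ _ (tphi R q _ \o fst) (res (tL R q) (cylXY _) \o snd)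
    (0, res (tL R q) cylY_compl l) (Zphi_compl_subproof l).
Lemma Zphi_compl_additive : zmod_morphism Zphi_compl_fun.
Proof.
move=> s t; apply: val_inj; apply: (congr2 pair); first exact: (esym (subr0 _)).
exact: raddfB.
Qed.
HB.instance Definition _ := GRing.isZmodMorphism.Build _ _ Zphi_compl_fun
  Zphi_compl_additive.

End At.

Lemma Zphi_glob_diff q (k : seccplx (tK R) (opensT X) q) :
  Zphi_glob_fun (shdiff (tK R) q _ k) = shdiff Zphi q _ (Zphi_glob_fun k).
Proof. by apply: val_inj; rewrite /= tphi_diff !shom_res. Qed.

Definition Zphi_glob :
    cmap (seccplx (tK R) (opensT X)) (seccplx Zphi (opensT (cylinder f))) :=
  @CMap (seccplx (tK R) (opensT X)) (seccplx Zphi (opensT (cylinder f)))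
    (fun q => @Zphi_glob_fun q) Zphi_glob_diff.

Lemma Zphi_compl_diff q (l : seccplx (tL R) (opensT Y) q) :
  Zphi_compl_fun (shdiff (tL R) q _ l) = shdiff Zphi q _ (Zphi_compl_fun l).
Proof. by apply: val_inj; rewrite /= raddf0 !shom_res. Qed.

Definition Zphi_compl : cmap (seccplx (tL R) (opensT Y)) (seccplx Zphi (cyl_compl f)) :=
  @CMap (seccplx (tL R) (opensT Y)) (seccplx Zphi (cyl_compl f))
    (fun q => @Zphi_compl_fun q) Zphi_compl_diff.

Lemma Zphi_glob_compl q (k : seccplx (tK R) (opensT X) q) :
  gres Zphi (cyl_compl f) q (Zphi_glob q k) = Zphi_compl q (gphi q k).
Proof.
apply: val_inj; apply: (congr2 pair); first exact: (sec_empty cylX_compl0).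
exact: res_comp.
Qed.

(** Induced by the identifications of [Z^*(phi)(Z(f))] with [K(X)] and of
    [Z^*(phi)(Z(f) \ X)] with [L(Y)]. *)
Definition comapping_cone_to_relcone : cmap comapping_cone (relcone Zphi (cyl_compl f)) :=
  cone_map Zphi_glob_compl.

(** [Phi : H^q(M^*(phi)) -> H^q(f; eta)] is canonical if, for every comparison
    of the resolutions [Z^*(phi)] and [F] of [Z^*(eta)] with a third, flabby
    one, <<Z^*(phi) --theta--> F' <--g-- F>>, over the identity of [Z^*(eta)],
    it is compatible with the maps that [theta] and [g] induce on cohomology:
<<
    H^q(M^*(phi)) -----------------Phi----------------> H^q(f; eta)
         |                                                  | g
         v                 theta                            v
    H^q(cone(Z^*(phi))) ----------> H^q(cone(F')) <--- H^q(F'(Z(f), Z(f) \ X))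
>>
    where cone(-) is the cone of the restriction of sections from [Z(f)] to
    [Z(f) \ X]. If [F'] is an injective resolution, [theta] and [g] exist, and
    the two arrows that lead from [H^q(f; eta)] to [H^q(cone(F'))] are
    isomorphisms, so there is at most one canonical [Phi]. *)
Definition is_canonical (F : flabby_resolution (Zstar eta)) (q : nat)
    (Phi : cohomology comapping_cone q -> map_cohomology F q) : Prop :=
  forall (F' : flabby_resolution (Zstar eta)) (theta : augmap Zphi F')
    (g : augmap F F') (c : cohomology comapping_cone q),
  cohom_map (ker_to_cone (gres F' (cyl_compl f)))
    (cohom_map (relcplx_map g (cyl_compl f)) (Phi c)) =
  cohom_map (relcone_map theta (cyl_compl f))
    (cohom_map comapping_cone_to_relcone c).

End Triple.

(* Main.v *)
Require Import Defs.
From HB Require Import structures.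
From mathcomp Require Import all_boot all_order all_algebra generic_quotient.
From mathcomp Require Import ring_quotient.
From mathcomp Require Import all_classical topology.

(** Let [Z = Z(f)], [W = Z \ X], and let [I] be an injective resolution of [Z^*(eta)],
    built from products of skyscraper sheaves with stalk [Q/Z]. The complex [Z^*(phi)] is
    a resolution of [Z^*(eta)], so it maps to [I], uniquely up to homotopy, and so does
    every flabby resolution [F]. The canonical map is the composite
<<
      H(M^*(phi)) = H(cone(Z^*(phi)(Z) -> Z^*(phi)(W)))
        -> H(cone(I(Z) -> I(W))) <- H(cone(F(Z) -> F(W))) <- H(F(Z, W)).
>>
    By the five lemma, the two maps to [H(cone(I(Z) -> I(W)))] are isomorphisms as soon as
    the maps on sections over [Z] and over [W] are quasi-isomorphisms, that is, as soon
    as the cone of the morphism of resolutions, an exact complex of sheaves, has exact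
    sections over [Z] and over [W]. For [F -> I] this holds because the cone is flabby.
    For [Z^*(phi) -> I], sections over [Z] are global sections of the inverse image
    on [X], because [Z] is the only neighbourhood of [X], and sections over [W] are global
    sections of the inverse image on [Y]. There the cone is soft, since flabby sheaves
    are soft on a paracompact space. *)

Set Implicit Arguments.
Unset Strict Implicit.
Unset Printing Implicit Defensive.

Import Order.TTheory GRing.Theory Num.Theory.
Local Open Scope classical_set_scope.
Local Open Scope ring_scope.
Local Open Scope quotient_scope.

(** * Extension of homomorphisms to [Q/Z] *)

(** Maps out of [Zphi R] need an injective target: its terms need not be flabby, and a flabby
    resolution need not receive a map from it. Cones of restrictions replace kernels because
    sections of [Z^*(phi)] over [Z] need not restrict onto those over [W]; for flabby sheaves cone
    and kernel have the same cohomology.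

    The encodings are chosen to avoid stalks, sheafification, and kernel or quotient sheaves.
    Injectivity extends [w] along any [u] whose kernel [w] kills; a cokernel to be embedded is kept
    as a sheaf with a subpresheaf; softness of a kernel is a property of the morphism; inverse
    images are read on smallest neighbourhoods. The five lemma takes the form of acyclicity of an
    iterated cone.

    [Q/Z] is used for two properties: divisibility extends characters, and torsion of every order
    lets them separate an element from a subgroup. The lifting argument for soft complexes is
    written for a class of sets, so that open sets serve [F -> I] and closed sets serve
    [Z^*(phi) -> I]. *)

Lemma int_subgroup_principal (P : int -> Prop) :
  P 0 -> (forall a b, P a -> P b -> P (a - b)) ->
  exists2 k : nat, P k & forall n, P n -> exists c, n = c * k%:Z.
Proof.
move=> P0 PB.
have PN a : P a -> P (- a) by move=> Pa; rewrite -sub0r; exact: PB.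
have PD a b : P a -> P b -> P (a + b).
  by move=> Pa Pb; rewrite -[b]opprK; apply: PB => //; exact: PN.
have PM c a : P a -> P (c * a).
  move=> Pa; have PMn (n : nat) : P (n%:Z * a).
    by elim: n => [|n IH]; rewrite ?mul0r // intS mulrDl mul1r; exact: PD.
  by case: c => n; rewrite ?NegzE ?mulNr; [|apply: PN]; exact: PMn.
(* The generator is the least positive member. The value 0 is kept for the zero subgroup; later it
   encodes an element of infinite order. *)
have [[k [k0 Pk]]|noP] := pselect (exists k : nat, (0 < k)%N /\ P k); last first.
  exists 0%N => // n Pn; exists 0; rewrite mul0r; apply: contrapT => n0; apply: noP.
  exists `|n|%N; rewrite absz_gt0; split; first exact/eqP.
  by case: n Pn {n0} => n Pn //=; rewrite -[_%:Z]opprK; apply: PN; rewrite -NegzE.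
have exP : exists k : nat, (0 < k)%N && `[< P k >].
  by exists k; rewrite k0; exact/asboolP.
case: (ex_minnP exP) => m /andP[m0 /asboolP Pm] mmin.
exists m => // n Pn; exists (n %/ m)%Z.
have := divz_eq n m; have /(_ (lt0n_neq0 m0)) := @modz_ge0 n m%:Z.
have /(_ m0) := @ltz_pmod n m%:Z.
have : P (n %% m)%Z.
  rewrite -[X in P X](addKr ((n %/ m)%Z * m)) -divz_eq addrC.
  by apply: PB => //; exact: PM.
case: (n %% m)%Z => // r Pr; rewrite ltz_nat => rm _ nE; rewrite {1}nE {nE}.
case: r Pr rm => [|r] Pr rm; first by rewrite addr0.
by move: (mmin r.+1 (introT (asboolP _) Pr)); rewrite leqNgt rm.
Qed.

Definition divisible (D : zmodType) : Prop :=
  forall (n : nat) (d : D), (0 < n)%N -> exists d', d' *+ n = d.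

(** For [n = 0] this says only that [D] is nonzero, which is what an element of infinite order
    modulo a subgroup requires. *)
Definition all_torsion (D : zmodType) : Prop :=
  forall n : nat, n <> 1%N -> exists2 d : D, d <> 0 & d *+ n = 0.

Section Extension.
Variables M D : zmodType.

(** [G] is the graph of an additive map from a subgroup of [M] to [D]. *)
Definition partial_additive (G : set (M * D)) : Prop :=
  [/\ G 0, forall a b, G a -> G b -> G (a - b) & forall d, G (0, d) -> d = 0].

Lemma partial_additiveZ G a (n : int) : partial_additive G -> G a -> G (a *~ n).
Proof.
move=> [G0 GB _] Ga.
have GN b : G b -> G (- b) by move=> Gb; rewrite -sub0r; exact: GB.
have GMn (k : nat) : G (a *+ k).
  elim: k => [|k IH]; rewrite ?mulr0n // mulrS -[_ *+ _]opprK.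
  by apply: GB => //; exact: GN.
by case: n => k; rewrite ?NegzE ?mulrNz; [|apply: GN]; exact: GMn.
Qed.

Lemma pair_mulrz (m : M) (d : D) (n : int) : (m, d) *~ n = (m *~ n, d *~ n).
Proof.
have h (k : nat) : (m, d) *+ k = (m *+ k, d *+ k).
  by elim: k => // k IH; rewrite !mulrS IH.
by case: n => k; rewrite ?NegzE ?mulrNz /= -?pmulrn h.
Qed.

(** The integers [n] with [m0 *~ n] in the domain of [G] are the multiples of some [k]. Divisibility
    gives [d0] with [k d0] the value prescribed at [k m0], so adjoining [(m0, d0)] keeps the graph
    single-valued. For [k = 0] nothing is prescribed and [d0 = 0] is taken. *)
Lemma partial_additive_extend1 (G : set (M * D)) (m0 : M) :
  divisible D -> partial_additive G ->
  exists G' : set (M * D), [/\ partial_additive G', G `<=` G' & exists d, G' (m0, d)].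
Proof.
move=> divD pG; have [G0 GB G1] := pG.
have [||k [d Gkd] kP] := @int_subgroup_principal (fun n => exists d, G (m0 *~ n, d)).
- by exists 0; rewrite mulr0z.
- move=> a b [d Gd] [d' Gd']; exists (d - d').
  by rewrite mulrzBr; exact: GB Gd Gd'.
have [d0 d0E] : exists d0, G ((m0, d0) *~ k).
  case: k Gkd {kP} => [|k] Gkd; first by exists 0; rewrite mulr0z.
  by have [d0 d0E] := divD k.+1 d isT; exists d0; rewrite pair_mulrz -[d0 *~ _]/(d0 *+ _) d0E.
pose G' : set (M * D) := [set a | exists n : int, G (a - (m0, d0) *~ n)].
exists G'; split; first split.
- by exists 0; rewrite mulr0z subr0.
- move=> a b [n Gn] [n' Gn']; exists (n - n').
  rewrite mulrzBr [X in G X](_ : _ = (a - (m0, d0) *~ n) - (b - (m0, d0) *~ n'));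
    first exact: GB.
  by rewrite !opprB addrACA [RHS]addrACA; congr (_ + _); rewrite addrC.
- move=> d' [n Gn].
  have [c nE] : exists c, n = c * k%:Z.
    have [|c cE] := kP (- n); last by exists (- c); rewrite mulNr -cE opprK.
    exists (d' - d0 *~ n); move: Gn; rewrite pair_mulrz mulrNz -[m0 *~ n in X in _ -> X]subr0.
    by rewrite opprB.
  have := partial_additiveZ c pG d0E; rewrite -mulrzA [_ * c]mulrC -nE => Gn'.
  have := GB _ _ Gn (partial_additiveZ (-1) pG Gn').
  by rewrite mulrNz mulr1z opprK subrK => /G1.
- by move=> a Ga; exists 0; rewrite mulr0z subr0.
- by exists d0, 1; rewrite mulr1z subrr.
Qed.

Lemma extend_additive (G : set (M * D)) :
  divisible D -> partial_additive G ->
  exists f : {additive M -> D}, forall m d, G (m, d) -> f m = d.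
Proof.
move=> divD pG; have G0 : G 0 by have [] := pG.
pose P : set (set (M * D)) := [set H | H = set0 \/ partial_additive H /\ G `<=` H].
have [F FP Ftot|H [PH Hmax]] := @Zorn_bigcup (M * D)%type P.
  have [[H0 [FH0 pH0 GH0]]|noH] :=
      pselect (exists H, [/\ F H, partial_additive H & G `<=` H]); last first.
    left; rewrite -subset0 => a [H FH Ha]; case: (FP _ FH) => [H0|[pH GH]].
      by rewrite H0 in Ha.
    by apply: noH; exists H.
  have FpH H a : F H -> H a -> partial_additive H.
    by move=> FH Ha; case: (FP _ FH) => [H00|[]//]; rewrite H00 in Ha.
  right; split; last by move=> a Ga; exists H0 => //; exact: GH0.
  split.
  - by exists H0 => //; case: pH0.
  - move=> a b [H FH Ha] [K FK Kb]; case: (Ftot _ _ FH FK) => [HK|KH].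
      by exists K => //; have [_ KB _] := FpH _ _ FK Kb; apply: KB => //; exact: HK.
    by exists H => //; have [_ HB _] := FpH _ _ FH Ha; apply: HB => //; exact: KH.
  - by move=> d [H FH Hd]; have [_ _ H1] := FpH _ _ FH Hd; exact: H1.
have {PH} [pH GH] : partial_additive H /\ G `<=` H.
  case: PH => // H0; exfalso; apply: (Hmax G); last by right; split.
  by rewrite H0; split => // /(_ _ G0).
have totH m : exists d, H (m, d).
  have [K [pK HK [d Kd]]] := partial_additive_extend1 m divD pH.
  exists d; apply: contrapT => nHd; apply: (Hmax K); last first.
    by right; split => // a /GH /HK.
  by split => // /(_ _ Kd).
have [_ HB H1] := pH.
have funH m d d' : H (m, d) -> H (m, d') -> d = d'.
  move=> Hd Hd'; apply/eqP; rewrite -subr_eq0; apply/eqP; apply: H1.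
  by have := HB _ _ Hd Hd'; rewrite [X in H X -> _](_ : _ = (m - m, d - d')) // subrr.
pose f m := projT1 (cid (totH m)).
have fH m : H (m, f m) by exact: (projT2 (cid (totH m))).
have f_additive : zmod_morphism f.
  by move=> m n; apply: (funH (m - n)) => //; exact: (HB _ _ (fH m) (fH n)).
pose fA := GRing.isZmodMorphism.Build _ _ f f_additive.
pose fm : {additive M -> D} := HB.pack f fA.
by exists fm => m d /GH Hd; apply: (funH m).
Qed.

End Extension.

(** If [k] generates the integers [n] with [m *~ n] in [N], then [k] is not 1. Sending [N] to 0 and
    [m] to a nonzero [d] killed by [k] is well defined on the subgroup that they generate, and
    divisibility extends it to [M]. *)
Lemma separating_additive (M D : zmodType) (N : set M) (m : M) :
  divisible D -> all_torsion D ->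
  N 0 -> (forall a b, N a -> N b -> N (a - b)) -> ~ N m ->
  exists f : {additive M -> D}, (forall n, N n -> f n = 0) /\ f m <> 0.
Proof.
move=> divD torD N0 NB Nm.
have [||k Nk kP] := @int_subgroup_principal (fun n => N (m *~ n)).
- by rewrite mulr0z.
- by move=> a b Na Nb; rewrite mulrzBr; exact: NB.
have [d d0 dk] : exists2 d : D, d <> 0 & d *+ k = 0.
  by apply: torD => k1; apply: Nm; rewrite k1 in Nk.
have [|f fE] := @extend_additive M D
    [set a | exists n : int, N (a.1 - m *~ n) /\ a.2 = d *~ n] divD.
  split.
  - by exists 0; rewrite !mulr0z subr0.
  - move=> a b [n [Nn aE]] [n' [Nn' bE]]; exists (n - n'); split; last first.
      by rewrite mulrzBr -aE -bE.
    rewrite mulrzBr [X in N X](_ : _ = (a.1 - m *~ n) - (b.1 - m *~ n')); first exact: NB.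
    by rewrite !opprB addrACA [RHS]addrACA; congr (_ + _); rewrite addrC.
  - move=> e [n [/= Nn ->]]; have [|c cE] := kP (- n); first by rewrite mulrNz -sub0r.
    rewrite -[n]opprK cE mulrNz mulrC mulrzA -[d *~ k]/(d *+ k) dk.
    by rewrite mul0rz oppr0.
exists f; split=> [n Nn|].
  by apply: fE; exists 0; rewrite !mulr0z subr0.
rewrite (fE m d) //; exists 1; rewrite !mulr1z subrr; split=> //.
Qed.

Definition int_pred : {pred rat} := [pred x | x \is a Num.int].
Lemma int_pred_closed : zmod_closed int_pred.
Proof. by split=> [|x y]; rewrite !inE ?rpred0 //; exact: rpredB. Qed.
HB.instance Definition _ := GRing.isZmodClosed.Build rat int_pred int_pred_closed.

Definition QmodZ : zmodType := Quotient.quot int_pred.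

Lemma QmodZ_pi_eq0 (x : rat) : (\pi_QmodZ x == 0 :> QmodZ) = (x \is a Num.int).
Proof. by rewrite -[0](raddf0 \pi_QmodZ) -Quotient.idealrBE subr0. Qed.

Lemma divisible_QmodZ : divisible QmodZ.
Proof.
move=> n d n0; exists (\pi_QmodZ (repr d / n%:R)).
rewrite -raddfMn [_ *+ n](_ : _ = repr d); first exact: reprK.
by rewrite -[LHS]mulr_natr divfK // pnatr_eq0 -lt0n.
Qed.

Lemma all_torsion_QmodZ : all_torsion QmodZ.
Proof.
(* The witness is the class of [1/n]; for [n = 0], where any nonzero class will do, it is that of
   [1/2]. *)
move=> n n1; pose k := if n is 0%N then 2%N else n.
have k0 : (k%:R : rat) != 0 by rewrite pnatr_eq0 /k; case: (n).
exists (\pi_QmodZ k%:R^-1).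
  apply/eqP; rewrite QmodZ_pi_eq0; apply/negP => /intrP[m mE].
  have /intr_inj/(congr1 absz) : 1%:~R = (m * k%:Z)%:~R :> rat.
    by rewrite intrM -mE -pmulrn mulVf.
  by rewrite abszM => /esym/eqP; rewrite muln_eq1 => /andP[_ /eqP]; rewrite /k; case: (n) n1.
case: n @k k0 {n1} => [|n] k k0; first by rewrite mulr0n.
by apply/eqP; rewrite -raddfMn QmodZ_pi_eq0 -[_ *+ _]mulr_natr mulVf // rpred1.
Qed.

(** * Injective resolutions *)

(** A homomorphism from the stalk [G_x] to [Q/Z], given on sections. *)
Record stalk_char (X : topologicalType) (G : sheaf X) (x : X) := StalkChar {
  chi :> forall U : opens X, G U -> QmodZ;
  chiB : forall U, oset U x -> forall s t : G U, chi (s - t) = chi s - chi t;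
  chi_res : forall (U V : opens X) (h : V `<=` U), oset V x ->
    forall s, chi (res G h s) = chi s }.
Arguments chi {X G x} _ U s.

(** Only presheaf conditions are imposed, because membership is tested near a point; the image of a
    morphism then qualifies as it stands. *)
Record subpresheaf (X : topologicalType) (G : sheaf X) := Subpresheaf {
  spmem :> forall U : opens X, G U -> Prop;
  spmem0 : forall U, spmem (0 : G U);
  spmemB : forall U (s t : G U), spmem s -> spmem t -> spmem (s - t);
  spmem_res : forall (U V : opens X) (h : V `<=` U) (s : G U), spmem s -> spmem (res G h s) }.
Arguments spmem {X G} _ U s.

Section StalkCharacters.
Variable X : topologicalType.

Definition opensI (U V : opens X) : opens X :=
  Opens (openI (oset_open U) (oset_open V)).
Lemma opensIl (U V : opens X) : opensI U V `<=` U. Proof. by move=> x []. Qed.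
Lemma opensIr (U V : opens X) : opensI U V `<=` V. Proof. by move=> x []. Qed.

(** One fixed group that replaces the stalks: a germ at [x] is represented by any family that agrees
    with the restrictions of a section on all small neighbourhoods of [x], with arbitrary values
    elsewhere. *)
Definition section_family (G : sheaf X) : Type := forall U : opens X, G U.

Section SectionFamily.
Variable G : sheaf X.
HB.instance Definition _ := gen_eqMixin (section_family G).
HB.instance Definition _ := gen_choiceMixin (section_family G).

Let zero : section_family G := fun=> 0.
Let add (m n : section_family G) : section_family G := fun U => m U + n U.
Let opp (m : section_family G) : section_family G := fun U => - m U.
Let addA : associative add.
Proof. by move=> m n p; apply: functional_extensionality_dep => U; exact: addrA. Qed.
Let addC : commutative add.
Proof. by move=> m n; apply: functional_extensionality_dep => U; exact: addrC. Qed.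
Let add0 : left_id zero add.
Proof. by move=> m; apply: functional_extensionality_dep => U; exact: add0r. Qed.
Let addN : left_inverse zero opp add.
Proof. by move=> m; apply: functional_extensionality_dep => U; exact: addNr. Qed.
HB.instance Definition _ := GRing.isZmodule.Build (section_family G) addA addC add0 addN.

Definition extend_family (U : opens X) (s : G U) : section_family G :=
  fun W => if pselect (W `<=` U) is left h then res G h s else 0.

Lemma extend_familyE (U W : opens X) (h : W `<=` U) s :
  extend_family s W = res G h s.
Proof. by rewrite /extend_family; case: pselect => // h'; exact: res_irrel. Qed.

Lemma extend_familyB (U : opens X) (s t : G U) :
  extend_family (s - t) = extend_family s - extend_family t.
Proof.
apply: functional_extensionality_dep => W.
rewrite -[RHS]/(extend_family s W - extend_family t W) /extend_family.
by case: pselect => h; rewrite ?raddfB ?subr0.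
Qed.

End SectionFamily.

(** The character is extended from the families that are given near [x] by a
    section in the image of [u] to all of [section_family C]; no stalk is formed. *)
Lemma stalk_char_lift (B C : sheaf X) (u : shom B C) (x : X) (a : stalk_char B x) :
  (forall U s, oset U x -> u U s = 0 -> a U s = 0) ->
  exists b : stalk_char C x, forall U s, oset U x -> b U (u U s) = a U s.
Proof.
move=> ker_a.
pose G : set (section_family C * QmodZ) := [set p | exists (V : opens X) (s : B V),
  [/\ oset V x, forall (W : opens X) (h : W `<=` V), oset W x ->
     p.1 W = u W (res B h s) & p.2 = a V s]].
have a0 V : oset V x -> a V 0 = 0 by move=> Vx; rewrite -(subrr 0) chiB // subrr.
have [|f fE] := @extend_additive _ _ G divisible_QmodZ.
  split.
  - exists (opensT X), 0; split=> //=; last by rewrite a0.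
    by move=> W h _; rewrite !raddf0.
  - move=> [m d] [m' d'] [V [s [Vx /= mE ->]]] [V' [s' [Vx' /= mE' ->]]].
    exists (opensI V V'), (res B (@opensIl V V') s - res B (@opensIr V V') s').
    split => //=; last by rewrite chiB // !chi_res.
    move=> W h Wx; have hl : W `<=` V by move=> z /h [].
    have hr : W `<=` V' by move=> z /h [].
    rewrite -[LHS]/(m W - m' W) (mE _ hl) // (mE' _ hr) // !raddfB.
    by rewrite (res_comp _ _ hl) (res_comp _ _ hr).
  - move=> d [V [s [Vx /= mE ->]]]; apply: ker_a => //.
    by have := mE V (@subset_refl _ _) Vx; rewrite res_id => <-.
have fext (U V : opens X) (h : V `<=` U) t : oset V x ->
    f (extend_family (res C h t)) = f (extend_family t).
  move=> Vx; apply/eqP; rewrite -subr_eq0 -raddfB; apply/eqP; apply: fE.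
  exists V, 0; split=> //; last by rewrite a0.
  move=> W hW Wx; rewrite /= !raddf0.
  rewrite -[LHS]/(extend_family (res C h t) W - extend_family t W).
  have hU : W `<=` U by move=> z /hW/h.
  by rewrite (extend_familyE hW) (extend_familyE hU) (res_comp _ _ hU) subrr.
exists (@StalkChar X C x (fun U t => f (extend_family t))
  (fun U _ s t => etrans (congr1 f (extend_familyB s t)) (raddfB f _ _))
  (fun U V h Vx t => fext U V h t Vx)).
move=> U s Ux; apply: fE; exists U, s; split => //= W h Wx.
by rewrite (extend_familyE h) shom_res.
Qed.

(** The hypothesis keeps the family of restrictions of [s] out of the subgroup [N'] of families that
    lie in [N] on all small neighbourhoods of [x]. A map to [Q/Z] that kills [N'] but not this
    family gives the character. *)
Lemma stalk_char_separates (G : sheaf X) (N : subpresheaf G) (U : opens X) (s : G U) (x : X) :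
  oset U x ->
  (forall (V : opens X) (h : V `<=` U), oset V x -> ~ N V (res G h s)) ->
  exists a : stalk_char G x, (forall V t, oset V x -> N V t -> a V t = 0) /\ a U s <> 0.
Proof.
move=> Ux Ns.
pose N' : set (section_family G) := [set m | exists2 V : opens X, oset V x &
  forall W : opens X, W `<=` V -> oset W x -> N W (m W)].
have [| | |f [fN fs]] :=
    @separating_additive _ _ N' (extend_family s) divisible_QmodZ all_torsion_QmodZ.
- by exists (opensT X) => // W _ _; exact: spmem0.
- move=> m n [V Vx Vm] [V' Vx' Vn]; exists (opensI V V') => // W h Wx.
  by apply: spmemB; [apply: Vm|apply: Vn] => // z /h [].
- move=> [V Vx Vs]; apply: (Ns (opensI U V) (@opensIl U V)) => //.
  by rewrite -extend_familyE; apply: Vs => //; exact: opensIr.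
have fext (V W : opens X) (h : W `<=` V) t : oset W x ->
    f (extend_family (res G h t)) = f (extend_family t).
  move=> Wx; apply/eqP; rewrite -subr_eq0 -raddfB; apply/eqP; apply: fN.
  exists W => // O hO Ox.
  rewrite -[X in N O X]/(extend_family (res G h t) O - extend_family t O).
  have hV : O `<=` V by move=> z /hO/h.
  rewrite (extend_familyE hO) (extend_familyE hV) (res_comp _ _ hV) subrr.
  exact: spmem0.
exists (@StalkChar X G x (fun U t => f (extend_family t))
  (fun U _ s t => etrans (congr1 f (extend_familyB s t)) (raddfB f _ _))
  (fun U V h Vx t => fext U V h t Vx)).
split=> // V t Vx Nt; apply: fN; exists V => // W h Wx.
by rewrite (extend_familyE h); exact: spmem_res.
Qed.

End StalkCharacters.

Section Skyscrapers.
Variables (X : topologicalType) (J : Type) (pt : J -> X).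

Definition sky_sec (W : opens X) : zmodType := {j : J | oset W (pt j)} -> QmodZ.

Definition sky_res (U V : opens X) (h : V `<=` U) (s : sky_sec U) : sky_sec V :=
  fun j => s (exist _ (sval j) (h _ (svalP j))).
Lemma sky_res_additive U V h : zmod_morphism (@sky_res U V h).
Proof. by move=> s t; apply/funext. Qed.
HB.instance Definition _ U V h :=
  GRing.isZmodMorphism.Build _ _ (@sky_res U V h) (@sky_res_additive U V h).

Lemma sky_secE (W : opens X) (s : sky_sec W) (j : J) (h h' : oset W (pt j)) :
  s (exist _ j h) = s (exist _ j h').
Proof. by congr s; exact: eq_exist. Qed.

(** The product of the skyscraper sheaves with stalk [Q/Z] at [pt j]. *)
Definition sky : sheaf X.
Proof.
apply: (@Sheaf X sky_sec (fun U V h => @sky_res U V h)).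
- by move=> U h s; apply/funext => -[j Uj]; exact: (sky_secE s).
- by move=> U V W h1 h2 h s; apply/funext => -[j Uj]; exact: (sky_secE s).
- move=> U I C hC cov s t st; apply/funext => -[j Uj].
  have [i _ Cj] := cov _ Uj.
  have /(congr1 (fun g => g (exist _ j Cj))) := st i.
  by rewrite /= /sky_res /= !(sky_secE _ _ Uj).
- move=> U I C hC cov s sC.
  pose c (j : {j : J | oset U (pt j)}) := cid2 (cov _ (svalP j)).
  exists (fun j => s (s2val (c j)) (exist _ (sval j) (s2valP' (c j)))) => i.
  apply/funext => -[j Cj]; rewrite /= /sky_res /=.
  set k := exist _ _ _; move: (s2val (c k)) (s2valP' (c k)) => i' Cj'.
  have := sC i i' (opensI (C i) (C i')) (@opensIl _ _ _) (@opensIr _ _ _).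
  move=> /(congr1 (fun g => g (exist _ j (conj Cj Cj')))).
  by rewrite /= /sky_res /= !(sky_secE _ _ Cj) !(sky_secE _ _ Cj').
Defined.

Lemma sky_flabby : flabby sky.
Proof.
move=> U s.
exists (fun j => if pselect (oset U (pt (sval j))) is left h then s (exist _ (sval j) h) else 0).
apply/funext => -[j Uj]; rewrite /= /sky_res /=.
by case: pselect => // Uj'; exact: sky_secE.
Qed.

Definition sky_char_fun (B : sheaf X) (w : shom B sky) (j : J) (U : opens X)
    (s : B U) : QmodZ :=
  if pselect (oset U (pt j)) is left h then w U s (exist _ j h) else 0.

Lemma sky_charE (B : sheaf X) (w : shom B sky) (j : J) (U : opens X) (s : B U)
    (h : oset U (pt j)) :
  sky_char_fun w j s = w U s (exist _ j h).
Proof. by rewrite /sky_char_fun; case: pselect => // h'; exact: sky_secE. Qed.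

Lemma sky_charB (B : sheaf X) (w : shom B sky) (j : J) (U : opens X) : oset U (pt j) ->
  forall s t : B U, sky_char_fun w j (s - t) = sky_char_fun w j s - sky_char_fun w j t.
Proof. by move=> h s t; rewrite !(sky_charE _ _ h) raddfB. Qed.

Lemma sky_char_res (B : sheaf X) (w : shom B sky) (j : J) (U V : opens X) (h : V `<=` U) :
  oset V (pt j) -> forall s, sky_char_fun w j (res B h s) = sky_char_fun w j s.
Proof.
move=> Vj s; rewrite (sky_charE _ _ Vj) (sky_charE _ _ (h _ Vj)) shom_res.
by rewrite /= /sky_res /=; exact: sky_secE.
Qed.

Definition sky_char (B : sheaf X) (w : shom B sky) (j : J) : stalk_char B (pt j) :=
  StalkChar (@sky_charB B w j) (@sky_char_res B w j).

Section ToSky.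
Variables (B : sheaf X) (a : forall j, stalk_char B (pt j)).

Definition to_sky_fun (U : opens X) (s : B U) : sky U := fun j => a (sval j) U s.
Lemma to_sky_fun_additive U : zmod_morphism (@to_sky_fun U).
Proof. by move=> s t; apply/funext => -[j Uj]; exact: chiB. Qed.
HB.instance Definition _ U :=
  GRing.isZmodMorphism.Build _ _ (@to_sky_fun U) (@to_sky_fun_additive U).
Lemma to_sky_res (U V : opens X) (h : V `<=` U) s :
  to_sky_fun (res B h s) = res sky h (to_sky_fun s).
Proof. by apply/funext => -[j Vj]; exact: chi_res. Qed.

Definition to_sky : shom B sky := @SHom _ B sky (fun U => @to_sky_fun U) to_sky_res.
End ToSky.

(** A morphism to [sky] amounts to one stalk character for each index, so it is extended index by
    index. *)
Lemma sky_injective (B C : sheaf X) (u : shom B C) (w : shom B sky) :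
  (forall U s, u U s = 0 -> w U s = 0) ->
  exists w' : shom C sky, forall U s, w' U (u U s) = w U s.
Proof.
move=> ker_w.
have ex_b j : exists b : stalk_char C (pt j),
    forall U s, oset U (pt j) -> b U (u U s) = sky_char w j U s.
  apply: stalk_char_lift => U s Uj /ker_w ws.
  by rewrite /= (sky_charE _ _ Uj) ws.
exists (to_sky (fun j => sval (cid (ex_b j)))) => U s; apply/funext => -[j Uj].
by rewrite /= /to_sky_fun /= (svalP (cid (ex_b j))) //=; exact: sky_charE.
Qed.

End Skyscrapers.

(** Dependent choice with an invariant: only a [good] term can be continued, so goodness travels
    with the recursion. It builds comparison maps and homotopies degree by degree. *)
Lemma dependent_sequence (T : nat -> Type) (good : forall n, T n -> Prop)
    (P : forall n, T n -> T n.+1 -> Prop) (t0 : T 0) :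
  good 0 t0 -> (forall n t, good n t -> exists2 t', P n t t' & good n.+1 t') ->
  exists f : forall n, T n, f 0 = t0 /\ forall n, P n (f n) (f n.+1).
Proof.
move=> g0 step.
pose F := fix F n : {t : T n | good n t} :=
  match n return {t : T n | good n t} with
  | 0 => exist _ t0 g0
  | n'.+1 => exist _ _ (s2valP' (cid2 (step n' _ (svalP (F n')))))
  end.
by exists (fun n => sval (F n)); split=> // n; exact: (s2valP (cid2 (step n _ (svalP (F n))))).
Qed.

Section SheafMorphisms.
Variable X : topologicalType.

Lemma section_eq0 (G : sheaf X) (U : opens X) (s : G U) :
  (forall x, oset U x -> exists (V : opens X) (h : V `<=` U), oset V x /\ res G h s = 0) ->
  s = 0.
Proof.
move=> s0.
pose C (x : {x : X | oset U x}) := projT1 (cid (s0 _ (svalP x))).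
have hC x : C x `<=` U := projT1 (cid (projT2 (cid (s0 _ (svalP x))))).
apply: (@sheaf_locality _ G U _ C hC) => [x Ux|[x Ux]]; rewrite /C.
  exists (exist _ x Ux) => //; case: (cid _) => V /= [h [Vx _]].
  exact: Vx.
move: (hC (exist _ x Ux)); rewrite /C; case: (cid _) => V /= [h [Vx sV]] h'.
by rewrite (res_irrel h' h) sV raddf0.
Qed.

Definition shom_comp (A B C : sheaf X) (v : shom B C) (u : shom A B) : shom A C :=
  @SHom _ A C (fun U => v U \o u U)
    (fun U V h s => etrans (congr1 (v V) (shom_res u h s)) (shom_res v h _)).

Section Sub.
Variables (A B : sheaf X) (u v : shom A B).
Definition shom_sub_fun (U : opens X) (s : A U) : B U := u U s - v U s.
Lemma shom_sub_additive U : zmod_morphism (@shom_sub_fun U).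
Proof.
move=> s t; rewrite /shom_sub_fun (raddfB (u U)) (raddfB (v U)) !opprB addrACA [RHS]addrACA.
by congr (_ + _); rewrite addrC.
Qed.
HB.instance Definition _ U :=
  GRing.isZmodMorphism.Build _ _ (@shom_sub_fun U) (@shom_sub_additive U).
Lemma shom_sub_res (U V : opens X) (h : V `<=` U) s :
  shom_sub_fun (res A h s) = res B h (shom_sub_fun s).
Proof. by rewrite /shom_sub_fun !shom_res raddfB. Qed.
Definition shom_sub : shom A B := @SHom _ A B (fun U => @shom_sub_fun U) shom_sub_res.
End Sub.

(** Passing to the quotient by the kernel of [u] and extending along a monomorphism are merged into
    one step, so that [u] can be a differential of a resolution. *)
Definition injective_sheaf (I : sheaf X) : Prop :=
  forall (B C : sheaf X) (u : shom B C) (w : shom B I),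
  (forall U s, u U s = 0 -> w U s = 0) ->
  exists w' : shom C I, forall U s, w' U (u U s) = w U s.

Lemma exact_at_kernel (A B C I : sheaf X) (u : shom A B) (v : shom B C) (w : shom B I) :
  exact_at u v -> (forall U t, w U (u U t) = 0) -> forall U s, v U s = 0 -> w U s = 0.
Proof.
move=> uv wu U s /uv sloc; apply: section_eq0 => x /sloc [V [h [t [Vx tE]]]].
by exists V, h; split => //; rewrite -shom_res -tE wu.
Qed.

End SheafMorphisms.

Section InjectiveResolution.
Variable X : topologicalType.

(** A stage stands for the quotient of [stB] by [stN]: the cokernel that the next term of the
    resolution has to contain. *)
Record stage := Stage { stB : sheaf X; stN : subpresheaf stB }.

Definition stage_index (t : stage) : Type := {x : X &
  {a : stalk_char (stB t) x | forall U s, oset U x -> stN t U s -> a U s = 0}}.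

(** An injective sheaf in which [stB t / stN t], a quotient of presheaves, embeds
    up to sections that vanish locally. *)
Definition envelope (t : stage) : sheaf X := sky (fun j : stage_index t => projT1 j).
Definition to_envelope (t : stage) : shom (stB t) (envelope t) :=
  to_sky (fun j : stage_index t => sval (projT2 j)).

(** There are enough characters: if no restriction of [s] around [x] lies in [stN t], then some
    character at [x] that kills [stN t] detects [s], and it is one of the indices of the
    envelope. *)
Lemma to_envelope_eq0 (t : stage) (U : opens X) (s : stB t U) :
  to_envelope t U s = 0 <->
  forall x, oset U x -> exists (V : opens X) (h : V `<=` U),
    oset V x /\ stN t V (res _ h s).
Proof.
split=> [s0 x Ux|sN].
  apply: contrapT => noV.
  have [|a [aN as0]] := @stalk_char_separates X (stB t) (stN t) U s x Ux.
    by move=> V h Vx Ns; apply: noV; exists V, h.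
  apply: as0; pose j : stage_index t := existT _ x (exist _ a aN).
  exact: (congr1 (fun g => g (exist _ j Ux)) s0).
apply/funext => -[[x [a aN]] /= Ux]; have [V [h [Vx Ns]]] := sN x Ux.
by rewrite /= /to_sky_fun /= -(chi_res a h Vx); exact: aN.
Qed.

Section Image.
Variables (B C : sheaf X) (u : shom B C).
Let mem (U : opens X) (s : C U) : Prop := exists t, u U t = s.
Let mem0 U : mem (0 : C U). Proof. by exists 0; rewrite raddf0. Qed.
Let memB U (s t : C U) : mem s -> mem t -> mem (s - t).
Proof. by move=> [s' <-] [t' <-]; exists (s' - t'); rewrite raddfB. Qed.
Let mem_res (U V : opens X) (h : V `<=` U) (s : C U) : mem s -> mem (res C h s).
Proof. by move=> [t <-]; exists (res B h t); rewrite shom_res. Qed.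
Definition image_presheaf : subpresheaf C := Subpresheaf mem0 memB mem_res.
End Image.

Section Zero.
Variable B : sheaf X.
Let mem (U : opens X) (s : B U) : Prop := s = 0.
Let memB U (s t : B U) : mem s -> mem t -> mem (s - t).
Proof. by move=> -> ->; exact: subr0. Qed.
Let mem_res (U V : opens X) (h : V `<=` U) (s : B U) : mem s -> mem (res B h s).
Proof. by move=> ->; exact: raddf0. Qed.
Definition zero_presheaf : subpresheaf B := @Subpresheaf _ B mem (fun=> erefl) memB mem_res.
End Zero.

Definition next_stage (t : stage) : stage := Stage (image_presheaf (to_envelope t)).

Variable A : sheaf X.
(** Stage 0 is [A] modulo zero, and stage [n.+1] is the [n]-th term modulo the image of the
    preceding map. Hence [to_envelope (stages 0)] is the augmentation and
    [to_envelope (stages q.+1)] the differential in degree [q]. *)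
Let stages (n : nat) : stage := iter n next_stage (Stage (zero_presheaf A)).

Let stages_diff (n : nat) U s : to_envelope (stages n.+1) U (to_envelope (stages n) U s) = 0.
Proof.
apply/to_envelope_eq0 => x Ux; exists U, (@subset_refl _ _); split=> //.
by exists s; rewrite res_id.
Qed.

Definition inj_resolution : augcplx A :=
  @AugCplx X A (fun q => envelope (stages q)) (to_envelope (stages 0))
    (fun q => to_envelope (stages q.+1)) (@stages_diff 0) (fun q => @stages_diff q.+1).

Lemma inj_resolution_injective q : injective_sheaf (inj_resolution q).
Proof. by move=> B C u w; exact: sky_injective. Qed.

Lemma inj_resolution_flabby q : flabby (inj_resolution q).
Proof. exact: sky_flabby. Qed.

Lemma inj_resolution_is_resolution : is_resolution inj_resolution.
Proof.
have ex n : exact_at (to_envelope (stages n)) (to_envelope (stages n.+1)).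
  move=> U s; rewrite to_envelope_eq0; split=> sloc x /sloc [V [h]].
    by move=> [Vx [t tE]]; exists V, h, t.
  by move=> [t [Vx tE]]; exists V, h; split => //; exists t.
split; [|exact: (ex 0)|by move=> q; exact: (ex q.+1)].
move=> U s t /eqP; rewrite -subr_eq0 -raddfB => /eqP/to_envelope_eq0 st.
apply/eqP; rewrite -subr_eq0; apply/eqP; apply: section_eq0 => x /st.
by move=> [V [h [Vx stV]]]; exists V, h.
Qed.

Definition inj_flabby_resolution : flabby_resolution A :=
  FlabbyResolution inj_resolution_is_resolution inj_resolution_flabby.

End InjectiveResolution.

(** * Maps into an injective resolution: existence, and uniqueness up to homotopy *)

Section Comparison.
Variables (X : topologicalType) (A : sheaf X) (K I : augcplx A).
Hypotheses (resK : is_resolution K) (injI : forall q, injective_sheaf (I q)).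

Lemma augmap_exists : inhabited (augmap K I).
Proof.
have [monoK exK0 exK] := resK.
have [u0 u0E] : exists u0 : shom (K 0) (I 0), forall U s, u0 U (aug K U s) = aug I U s.
  apply: injI => U s /eqP; rewrite -(raddf0 (aug K U)) => /eqP/monoK ->.
  exact: raddf0.
(* The invariant is the condition under which injectivity extends [shdiff I q] after [u] along
   [shdiff K q]. *)
pose good q (u : shom (K q) (I q)) :=
  forall U s, shdiff K q U s = 0 -> shdiff I q U (u U s) = 0.
have [||u [uE0 uE]] := @dependent_sequence (fun q => shom (K q) (I q)) good
   (fun q u u' => forall U s, u' U (shdiff K q U s) = shdiff I q U (u U s)) u0.
- apply: (exact_at_kernel (w := shom_comp (shdiff I 0) u0) exK0) => U s /=.
  by rewrite u0E aug_diff.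
- move=> q u gu; have [u' u'E] := injI (w := shom_comp (shdiff I q) u) gu.
  exists u' => //.
  apply: (exact_at_kernel (w := shom_comp (shdiff I q.+1) u') (exK q)) => U s /=.
  by rewrite u'E shdiffK.
by constructor; exists u => //; rewrite uE0.
Qed.

Lemma augmap_homotopy (u v : augmap K I) :
  exists h : forall q, shom (K q.+1) (I q),
    (forall U s, u 0 U s - v 0 U s = h 0 U (shdiff K 0 U s)) /\
    (forall q U s, u q.+1 U s - v q.+1 U s =
       shdiff I q U (h q U s) + h q.+1 U (shdiff K q.+1 U s)).
Proof.
have [monoK exK0 exK] := resK.
have [h0 h0E] : exists h0 : shom (K 1) (I 0),
    forall U s, h0 U (shdiff K 0 U s) = shom_sub (u 0) (v 0) U s.
  apply: injI; apply: (exact_at_kernel exK0) => U s.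
  by rewrite /= /shom_sub_fun !augmap_aug subrr.
(* What is left of [u - v] in degree [q.+1] once the differential of [h] is subtracted; the next
   homotopy component extends it along [shdiff K q.+1]. *)
pose w q (h : shom (K q.+1) (I q)) :=
  shom_sub (shom_sub (u q.+1) (v q.+1)) (shom_comp (shdiff I q) h).
pose good q (h : shom (K q.+1) (I q)) :=
  forall U s, shdiff K q.+1 U s = 0 -> w q h U s = 0.
have [||h [hE0 hE]] := @dependent_sequence (fun q => shom (K q.+1) (I q)) good
   (fun q h h' => forall U s, h' U (shdiff K q.+1 U s) = w q h U s) h0.
- apply: (exact_at_kernel (exK 0)) => U s.
  rewrite /= /shom_sub_fun /= /shom_sub_fun /= h0E /= /shom_sub_fun raddfB.
  by rewrite !augmap_diff subrr.
- move=> q h gh; have [h' h'E] := injI gh.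
  exists h' => //; apply: (exact_at_kernel (exK q.+1)) => U s.
  rewrite /= /shom_sub_fun /= /shom_sub_fun /= h'E /= /shom_sub_fun /= /shom_sub_fun /=.
  by rewrite 2!(raddfB (shdiff I q.+1 U)) shdiffK subr0 !augmap_diff subrr.
exists h; split=> [U s|q U s]; first by rewrite hE0 h0E.
by rewrite hE /= /shom_sub_fun /= /shom_sub_fun /= [RHS]addrC subrK.
Qed.

End Comparison.

(** * Cones and cohomology *)

Section CohomologyFacts.
Implicit Types A B C : cochain.

Lemma cohclassP C q (z z' : cocycle C q) :
  cohclass z = cohclass z' <-> is_coboundary (\val z - \val z').
Proof.
have E : (z - z' \in @coboundary C q) = (cohclass z == cohclass z').
  exact: Quotient.idealrBE.
have vB : \val (z - z') = \val z - \val z' by exact: (raddfB \val).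
rewrite -vB; split=> [/eqP|h]; first by rewrite -E => /asboolP.
by apply/eqP; rewrite -E; apply/asboolP.
Qed.

Lemma cohclass_repr C q (c : cohomology C q) : exists z : cocycle C q, cohclass z = c.
Proof. by exists (repr c); exact: reprK. Qed.

Lemma cohom_map_additive A B (u : cmap A B) q : zmod_morphism (@cohom_map A B u q).
Proof.
move=> c c'; have [z <-] := cohclass_repr c; have [z' <-] := cohclass_repr c'.
have clB C (x y : cocycle C q) : cohclass x - cohclass y = cohclass (x - y).
  exact: (esym (raddfB \pi_(Quotient.quot (@coboundary C q)) x y)).
rewrite clB !cohom_map_class clB; congr cohclass; apply: val_inj => /=.
by rewrite !raddfB.
Qed.
HB.instance Definition _ A B (u : cmap A B) q :=
  GRing.isZmodMorphism.Build _ _ (@cohom_map A B u q) (@cohom_map_additive A B u q).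

Lemma cohom_map_bij A B (u : cmap A B) q :
  (forall x : A q, cdiff A q x = 0 -> is_coboundary (u q x) -> is_coboundary x) ->
  (forall y : B q, cdiff B q y = 0 ->
     exists2 x : A q, cdiff A q x = 0 & is_coboundary (u q x - y)) ->
  bijective (@cohom_map A B u q).
Proof.
move=> inj_u surj_u; have injU : injective (@cohom_map A B u q).
  move=> c c'; have [z <-] := cohclass_repr c; have [z' <-] := cohclass_repr c'.
  rewrite !cohom_map_class => /cohclassP /=; rewrite -raddfB => h.
  by apply/cohclassP; apply: inj_u => //; rewrite raddfB !kernelE subr0.
have surjU d : exists c, @cohom_map A B u q c = d.
  have [z <-] := cohclass_repr d; have [x xz h] := surj_u _ (kernelE z).
  by exists (cohclass (mkker xz)); rewrite cohom_map_class; apply/cohclassP.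
exists (fun d => sval (cid (surjU d))) => c; last exact: svalP (cid (surjU c)).
by apply: injU; exact: svalP (cid (surjU _)).
Qed.

Lemma cohom_map_comp A B C (u : cmap A B) (v : cmap B C) (w : cmap A C) q :
  (forall x : A q, v q (u q x) = w q x) ->
  forall c, @cohom_map B C v q (@cohom_map A B u q c) = @cohom_map A C w q c.
Proof.
move=> uv c; have [z <-] := cohclass_repr c.
by rewrite !cohom_map_class; congr cohclass; apply: val_inj; exact: uv.
Qed.

Lemma cohom_map_square A B B' C (u : cmap A B) (v : cmap B C)
    (u' : cmap A B') (v' : cmap B' C) q :
  (forall x : A q, v q (u q x) = v' q (u' q x)) ->
  forall c, @cohom_map B C v q (@cohom_map A B u q c) =
            @cohom_map B' C v' q (@cohom_map A B' u' q c).
Proof.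
move=> uv c; have [z <-] := cohclass_repr c.
by rewrite !cohom_map_class; congr cohclass; apply: val_inj; exact: uv.
Qed.

Lemma eq_cohom_map A B (u v : cmap A B) q :
  (forall x : A q, cdiff A q x = 0 -> is_coboundary (u q x - v q x)) ->
  @cohom_map A B u q =1 @cohom_map A B v q.
Proof.
move=> uv c; have [z <-] := cohclass_repr c.
by rewrite !cohom_map_class; apply/cohclassP; exact: uv (kernelE z).
Qed.

Definition acyclic C : Prop := forall q (x : C q), cdiff C q x = 0 -> is_coboundary x.

(** For a cocycle [x], the pair [(x, y)] is a cocycle of the cone when [u x = d y], and a primitive
    of it makes [x] a coboundary. A primitive of [(0, y)], for a cocycle [y], gives a cocycle whose
    image is cohomologous to [y]. *)
Lemma acyclic_cone_bij A B (u : cmap A B) : acyclic (cone u) ->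
  forall q, bijective (@cohom_map A B u q).
Proof.
move=> acu q; apply: cohom_map_bij.
  case: q => [|q] x dx /=; first by move=> ux; apply: (acu 0); exact: congr2 dx ux.
  move=> [y dy]; have [|x'] := acu q.+1 (x, y); first by rewrite /= dx dy subrr.
  case: q x dx y dy x' => [|q] x dx y dy x' /= /(congr1 fst) /= <-; first by exists x'.
  by exists x'.1.
move=> y dy; have [|] := acu q.+1 ((0, y) : cone u q.+1).
  by rewrite /= !raddf0 dy subr0.
case: q y dy => [|q] y dy /= x [dx xy].
  by exists x => //=; rewrite xy subrr.
exists x.1 => //=; exists x.2; by rewrite -xy opprB addrC subrK.
Qed.

(** A lift [m] of the second component [y.2] turns a cocycle [y] of the cone into [y.1 - d m], which
    lies in the kernel of [u]; the two differ by the boundary of [m]. *)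
Lemma ker_to_cone_bij A B (u : cmap A B) q :
  (forall q (y : B q), exists x : A q, u q x = y) ->
  bijective (@cohom_map _ _ (ker_to_cone u) q).
Proof.
move=> surj_u; apply: cohom_map_bij.
  case: q => [|q] x dx /=; first by move=> x0; apply: val_inj.
  move=> [y]; case: q x dx y => [|q] x dx /= y [yx yu].
    by exists (mkker yu); apply: val_inj.
  have [m mE] := surj_u q y.2.
  have ker_y : u q.+1 (y.1 - cdiff A q m) = 0.
    by rewrite raddfB cmap_diff mE yu.
  exists (mkker ker_y); apply: val_inj.
  by rewrite /= raddfB [cdiff A q.+1 (cdiff _ _ _)]cdiffK subr0.
case: q => [|q] y.
  move=> /= [dy uy]; exists (mkker uy) => /=; last by rewrite subrr.
  exact: val_inj.
move=> /= [dy uy]; have [m mE] := surj_u q y.2.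
have ker_y : u q.+1 (y.1 - cdiff A q m) = 0.
  by rewrite raddfB cmap_diff mE uy.
exists (mkker ker_y).
  by apply: val_inj; rewrite /= raddfB [cdiff A q.+1 (cdiff _ _ _)]cdiffK subr0.
case: q y dy uy m mE ker_y => [|q] [y1 y2] dy uy m mE ker_y /=.
  exists (- m); rewrite /= !raddfN mE; apply: (congr2 pair); last by rewrite sub0r.
  by rewrite addrAC subrr sub0r.
exists (- m, 0); rewrite /= !raddfN raddf0 subr0 mE.
apply: (congr2 pair); last by rewrite sub0r.
by rewrite addrAC subrr sub0r.
Qed.

Section ConeMapAcyclic.
Variables (A B A' B' : cochain) (u : cmap A B) (u' : cmap A' B').
Variables (a : cmap A A') (b : cmap B B').
Hypothesis ab : forall q x, u' q (a q x) = b q (u q x).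

Let cone_reduce q (x : A q.+1) (y : B q) (x' : A' q) : acyclic (cone a) ->
  cdiff A q.+1 x = 0 -> u q.+1 x = cdiff B q y -> a q.+1 x = cdiff A' q x' ->
  exists w : cone a q, cdiff (cone a) q w = (x, x').
Proof. by move=> aca dx ux ax; apply: (aca q.+1); rewrite /= dx ax subrr. Qed.

(** Absorbs the case of degree 0, where [v] and [z] have a single component, and keeps it out of the
    main computation. *)
Let cone_splice q (v : cone b q) (w : A' q) :
  exists (v1 : B q) (z : cone u' q), cdiff B q v1 = (cdiff (cone b) q v).1 /\
    cdiff (cone u') q z = (cdiff A' q w, u' q w - b q v1 + (cdiff (cone b) q v).2).
Proof.
case: q v w => [|q] v w /=; first by exists v, w; rewrite /= subrK.
by exists v.1, (w, v.2); rewrite /= addrA subrK.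
Qed.

(** In a cocycle of the iterated cone the components in [A] and [A'] form a cocycle of [cone a].
    Subtracting the boundary of a primitive leaves components in [B] and [B'], which acyclicity of
    [cone b] removes. *)
Lemma acyclic_cone_map : acyclic (cone a) -> acyclic (cone b) ->
  acyclic (cone (cone_map ab)).
Proof.
move=> aca acb [|[|q]].
- move=> x /= [dx ux ax]; apply: (aca 0); exact: (congr2 pair dx ax).
- move=> [[x y] x'] [dx uxy axx' byx'].
  have ux := subr0_eq uxy; have ax := subr0_eq axx'.
  have by' := subr0_eq byx'.
  have [w [wx wx']] := cone_reduce aca dx ux ax.
  have yw : y - u 0 w = 0.
    apply: (acb 0); apply: (congr2 pair).
      by rewrite raddfB -cmap_diff wx ux subrr.
    by rewrite raddfB -ab wx' [b 0 y]by' subrr.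
  exists w; apply: (congr2 pair) => //; apply: (congr2 pair) => //.
  exact: esym (subr0_eq yw).
- move=> [[x y] [x' y']] [dx uxy axx' byx'].
  have ux := subr0_eq uxy; have ax := subr0_eq axx'.
  have by' := subr0_eq byx'.
  have [w wE] := cone_reduce aca dx ux ax.
  pose wA := (w : A q.+1 * A' q).1; pose wA' := (w : A q.+1 * A' q).2.
  have wx : cdiff A q.+1 wA = x := congr1 fst wE.
  have wx' : a q.+1 wA - cdiff A' q wA' = x' := congr1 snd wE.
  (* The rest of the cocycle after subtracting the boundary of [((wA, 0), (wA', 0))]. The component
     in [B'] changes sign because its differential enters the iterated cone with two minus signs and
     [cone b] with one. *)
  have [|v vE] := acb q.+1 (y - u q.+1 wA, - u' q wA' - y').
    apply: (congr2 pair).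
      by rewrite raddfB -cmap_diff wx ux subrr.
    have E (V : zmodType) (P Q R : V) : P - Q - R - P - (- Q - R) = 0.
      by rewrite (addrAC _ (- R)) (addrAC P) subrr sub0r subrr.
    rewrite /= (raddfB (b q.+1)) [b q.+1 y]by' -ab -wx' (raddfB (u' q.+1)).
    by rewrite cmap_diff (raddfB (cdiff B' q)) (raddfN (cdiff B' q)) E.
  have [v1 [z [v1E zE]]] := cone_splice v wA'.
  exists ((wA, - v1), z) => /=; apply: (congr2 pair); apply: (congr2 pair) => //.
  - by rewrite raddfN opprK v1E vE addrC subrK.
  - by rewrite zE wx'.
  - rewrite zE vE /= raddfN opprD opprD opprB !opprK.
    by rewrite -[b q v1 - _ + _]addrA !addKr.
Qed.

End ConeMapAcyclic.

Lemma cone_map_homotopy A B A' B' (u : cmap A B) (u' : cmap A' B')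
    (a1 a2 : cmap A A') (b1 b2 : cmap B B')
    (ab1 : forall q x, u' q (a1 q x) = b1 q (u q x))
    (ab2 : forall q x, u' q (a2 q x) = b2 q (u q x))
    (h : forall q, {additive A q.+1 -> A' q}) (k : forall q, {additive B q.+1 -> B' q}) :
  (forall x, a1 0 x - a2 0 x = h 0 (cdiff A 0 x)) ->
  (forall q x, a1 q.+1 x - a2 q.+1 x = cdiff A' q (h q x) + h q.+1 (cdiff A q.+1 x)) ->
  (forall x, b1 0 x - b2 0 x = k 0 (cdiff B 0 x)) ->
  (forall q x, b1 q.+1 x - b2 q.+1 x = cdiff B' q (k q x) + k q.+1 (cdiff B q.+1 x)) ->
  (forall q x, u' q (h q x) = k q (u q.+1 x)) ->
  forall q, @cohom_map _ _ (cone_map ab1) q =1 @cohom_map _ _ (cone_map ab2) q.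
Proof.
move=> h0 hS k0 kS hk q; apply: eq_cohom_map.
case: q => [|[|q]] x /=.
- by move=> [dx _]; rewrite h0 dx raddf0.
- move=> [dx /eqP]; rewrite subr_eq0 => /eqP ux.
  exists (h 0 x.1); rewrite /= hk ux -k0; apply: (congr2 pair) => //.
  by rewrite hS dx raddf0 addr0.
- move=> [dx /eqP]; rewrite subr_eq0 => /eqP ux.
  exists (h q.+1 x.1, - k q x.2); rewrite /= hk ux; apply: (congr2 pair).
    by rewrite hS dx raddf0 addr0.
  by rewrite kS raddfN opprK addrC.
Qed.

End CohomologyFacts.

(** * Exactness of sections of soft complexes *)

Section LocalSections.
Variables (X : topologicalType) (G : sheaf X).

Definition lsec : Type := {U : opens X & G U}.
Definition ldom (p : lsec) : opens X := projT1 p.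
Definition lmk (U : opens X) (s : G U) : lsec := existT _ U s.

(** Equality of germs at [x], as a relation between representatives: sections over a set are then
    functions to local sections instead of functions to equivalence classes. *)
Definition eqnear (x : X) (p r : lsec) : Prop :=
  exists (W : opens X) (hp : W `<=` ldom p) (hr : W `<=` ldom r),
    oset W x /\ res G hp (projT2 p) = res G hr (projT2 r).

Lemma eqnear_refl x p : oset (ldom p) x -> eqnear x p p.
Proof. by move=> px; exists (ldom p), (@subset_refl _ _), (@subset_refl _ _). Qed.

Lemma eqnear_sym x p r : eqnear x p r -> eqnear x r p.
Proof. by move=> [W [hp [hr [Wx pr]]]]; exists W, hr, hp. Qed.

Lemma eqnear_trans x p r t : eqnear x p r -> eqnear x r t -> eqnear x p t.
Proof.
move=> [W [hp [hr [Wx pr]]]] [W' [hr' [ht [Wx' rt]]]].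
have hl := @opensIl _ W W'; have hr'' := @opensIr _ W W'.
have kp : opensI W W' `<=` ldom p by move=> z /hl/hp.
have kt : opensI W W' `<=` ldom t by move=> z /hr''/ht.
have kr : opensI W W' `<=` ldom r by move=> z /hl/hr.
exists (opensI W W'), kp, kt; split=> //.
by rewrite -(res_comp hp hl) pr (res_comp _ _ kr) -(res_comp hr' hr'' kr) rt res_comp.
Qed.

Lemma eqnear_nbhs x p r : eqnear x p r ->
  exists2 W : opens X, oset W x & forall z, oset W z -> eqnear z p r.
Proof.
by move=> [W [hp [hr [Wx pr]]]]; exists W => // z Wz; exists W, hp, hr.
Qed.

Lemma eqnear_lres x (p : lsec) (V : opens X) (h : V `<=` ldom p) :
  oset V x -> eqnear x (lmk (res G h (projT2 p))) p.
Proof. by move=> Vx; exists V, (@subset_refl _ _), h; rewrite res_id. Qed.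

Lemma eqnear_res x (U V : opens X) (h : V `<=` U) (s : G U) :
  oset V x -> eqnear x (lmk (res G h s)) (lmk s).
Proof. exact: (@eqnear_lres x (lmk s)). Qed.

Lemma eqnear_eq (U : opens X) (s t : G U) :
  (forall x, oset U x -> eqnear x (lmk s) (lmk t)) -> s = t.
Proof.
move=> st; apply/eqP; rewrite -subr_eq0; apply/eqP; apply: section_eq0 => x /st.
move=> [W [h [h' [Wx sW]]]]; exists W, h; split=> //.
by rewrite raddfB (res_irrel h h' t) -sW subrr.
Qed.

(** A section over an arbitrary set [M], given by local sections around the
    points of [M] with coherent germs; the values outside [M] are irrelevant. *)
Definition is_section (M : set X) (p : X -> lsec) : Prop :=
  forall x, M x -> exists O : opens X,
    [/\ oset O x, O `<=` ldom (p x) &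
        forall z, M z -> oset O z -> eqnear z (p z) (p x)].

Lemma is_section_sub (M N : set X) p : N `<=` M -> is_section M p -> is_section N p.
Proof.
by move=> NM pM x /NM/pM [O [Ox Op Oz]]; exists O; split => // z /NM; exact: Oz.
Qed.

Lemma is_section_dom (M : set X) p x : is_section M p -> M x -> oset (ldom (p x)) x.
Proof. by move=> pM /pM [O [Ox /(_ _ Ox)]]. Qed.

Lemma is_section_cst (M : set X) r : M `<=` ldom r -> is_section M (fun=> r).
Proof.
move=> Mr x Mx; exists (ldom r).
by split => // [|z _]; [exact: Mr|exact: eqnear_refl].
Qed.

Lemma glue_section (N : opens X) p : is_section N p ->
  exists s : G N, forall x, oset N x -> eqnear x (lmk s) (p x).
Proof.
move=> pN.
have ex_O (i : {x | oset N x}) := cid (pN _ (svalP i)).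
pose C i := opensI (sval (ex_O i)) N.
have hN i : C i `<=` N by exact: opensIr.
have hp i : C i `<=` ldom (p (sval i)).
  by move=> z []; case: (svalP (ex_O i)) => _ h _ /h.
have cov : N `<=` \bigcup_i C i.
  by move=> x Nx; exists (exist _ x Nx) => //; split=> //; case: (svalP (ex_O (exist _ x Nx))).
have Cz i z : oset (C i) z -> eqnear z (p z) (p (sval i)).
  by move=> [Oz Nz]; case: (svalP (ex_O i)) => _ _ /(_ _ Nz Oz).
have [|s sE] := @sheaf_gluing _ G _ _ _ hN cov (fun i => res G (hp i) (projT2 (p (sval i)))).
  move=> i j W hi hj; apply: eqnear_eq => x Wx.
  apply: (eqnear_trans (eqnear_res hi _ Wx)); apply: eqnear_sym.
  apply: (eqnear_trans (eqnear_res hj _ Wx)).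
  apply: (eqnear_trans (eqnear_lres (hp j) (hj _ Wx))); apply: eqnear_sym.
  apply: (eqnear_trans (eqnear_lres (hp i) (hi _ Wx))).
  exact: eqnear_trans (eqnear_sym (Cz _ _ (hi _ Wx))) (Cz _ _ (hj _ Wx)).
exists s => x Nx; pose i : {x | oset N x} := exist _ x Nx.
have Cx : oset (C i) x by split=> //; case: (svalP (ex_O i)).
by exists (C i), (hN i), (hp i); rewrite /= sE.
Qed.

Definition lzero : lsec := lmk (0 : G (opensT X)).

Lemma eqnear_zeroP x p : eqnear x p lzero <->
  exists (W : opens X) (h : W `<=` ldom p), oset W x /\ res G h (projT2 p) = 0.
Proof.
split=> [[W [h [h' [Wx pE]]]]|[W [h [Wx pE]]]].
  by exists W, h; rewrite pE raddf0.
by exists W, h, (sub_opensT W); rewrite pE raddf0.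
Qed.

Definition ladd (p r : lsec) : lsec :=
  lmk (res G (@opensIl _ (ldom p) (ldom r)) (projT2 p) + res G (@opensIr _ _ _) (projT2 r)).
Definition lsub (p r : lsec) : lsec :=
  lmk (res G (@opensIl _ (ldom p) (ldom r)) (projT2 p) - res G (@opensIr _ _ _) (projT2 r)).

Lemma eqnear_sub x p r p' r' :
  eqnear x p p' -> eqnear x r r' -> eqnear x (lsub p r) (lsub p' r').
Proof.
move=> [W [hp [hp' [Wx pE]]]] [V [hr [hr' [Vx rE]]]].
have hW := @opensIl _ W V; have hV := @opensIr _ W V.
have k : opensI W V `<=` ldom (lsub p r) by move=> z [/hp ? /hr ?].
have k' : opensI W V `<=` ldom (lsub p' r') by move=> z [/hp' ? /hr' ?].
exists (opensI W V), k, k'; split => //=; rewrite !raddfB.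
have kp : opensI W V `<=` ldom p by move=> z /hW/hp.
have kr : opensI W V `<=` ldom r by move=> z /hV/hr.
have kp' : opensI W V `<=` ldom p' by move=> z /hW/hp'.
have kr' : opensI W V `<=` ldom r' by move=> z /hV/hr'.
rewrite (res_comp _ _ kp) (res_comp _ _ kr) (res_comp _ _ kp') (res_comp _ _ kr').
by rewrite -(res_comp hp hW) pE res_comp -(res_comp hr hV) rE res_comp.
Qed.

Lemma eqnear_addl x p r t : eqnear x t (lsub p r) -> eqnear x (ladd t r) p.
Proof.
move=> [W [ht [h [Wx tE]]]].
have hp : W `<=` ldom p by move=> z /h [].
have hr : W `<=` ldom r by move=> z /h [].
have k : W `<=` ldom (ladd t r) by move=> z Wz; exact: (conj (ht z Wz) (hr z Wz)).
exists W, k, hp; split=> //=.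
rewrite raddfD (res_comp _ _ ht) (res_comp _ _ hr) tE /= raddfB.
by rewrite (res_comp _ _ hp) (res_comp _ _ hr) subrK.
Qed.

Lemma eqnear_subr0 x p r : eqnear x p r -> eqnear x (lsub p r) lzero.
Proof.
move=> [W [hp [hr [Wx pE]]]].
have h : W `<=` ldom (lsub p r) by move=> z Wz; exact: (conj (hp z Wz) (hr z Wz)).
apply/eqnear_zeroP; exists W, h; split=> //=.
by rewrite raddfB (res_comp _ _ hp) (res_comp _ _ hr) pE subrr.
Qed.

Lemma is_section_lsub (M : set X) p r :
  is_section M p -> is_section M r -> is_section M (fun x => lsub (p x) (r x)).
Proof.
move=> pM rM x Mx; have [O [Ox Op Oz]] := pM x Mx; have [O' [Ox' Or Oz']] := rM x Mx.
exists (opensI O O'); split=> // [z [/Op ? /Or ?] //|z Mz [? ?]].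
by apply: eqnear_sub; [exact: Oz|exact: Oz'].
Qed.

End LocalSections.
Arguments lzero {X G}.

Section LocalMap.
Variables (X : topologicalType) (A B : sheaf X) (u : shom A B).

Definition lmap (p : lsec A) : lsec B := lmk (u _ (projT2 p)).

Lemma eqnear_map x p r : eqnear x p r -> eqnear x (lmap p) (lmap r).
Proof.
by move=> [W [hp [hr [Wx pr]]]]; exists W, hp, hr; split => //=; rewrite -!shom_res pr.
Qed.

Lemma lmap_sub p r : lmap (lsub p r) = lsub (lmap p) (lmap r).
Proof. by rewrite /lmap /lsub /= raddfB !shom_res. Qed.

Lemma lmap_add p r : lmap (ladd p r) = ladd (lmap p) (lmap r).
Proof. by rewrite /lmap /ladd /= raddfD !shom_res. Qed.

End LocalMap.

Section Softness.
Variables (X : topologicalType) (CC : set (set X)).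

(** Softness for [CC] the closed sets; follows from flabbiness for [CC] the open sets. *)
Definition csoft (G : sheaf X) : Prop :=
  forall (M : set X) p, CC M -> is_section M p ->
  exists t : gsec G, forall x, M x -> eqnear x (lmk t) (p x).

(** Softness of the kernel of [u], stated without forming the kernel sheaf. *)
Definition csoft_ker (A B : sheaf X) (u : shom A B) : Prop :=
  forall (M : set X) p, CC M -> is_section M p ->
  (forall x, M x -> eqnear x (lmap u (p x)) lzero) ->
  exists2 t : gsec A, u _ t = 0 & forall x, M x -> eqnear x (lmk t) (p x).

(** [D] behaves like an open cover, or like a locally finite closed cover. *)
Definition well_covering (D : set (set X)) : Prop :=
  forall (J : set (set X)) x, J `<=` D -> (\bigcup_(V in J) V) x ->
  exists J0 : set (set X), [/\ finite_set J0, J0 `<=` J, forall V, J0 V -> V x &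
    exists2 O : opens X, oset O x &
      forall z, oset O z -> (\bigcup_(V in J) V) z -> (\bigcup_(V in J0) V) z].

(** What open sets in any space and closed sets in a paracompact space have in common, and what the
    lifting argument uses. *)
Definition good_class : Prop :=
  (forall M N, CC M -> CC N -> CC (M `&` N)) /\
  forall (M : set X) (O : X -> opens X), CC M -> (forall x, M x -> oset (O x) x) ->
  exists D : set (set X),
    [/\ \bigcup_(V in D) V = M, forall J, J `<=` D -> CC (\bigcup_(V in J) V),
        forall V, D V -> exists2 x, M x & V `<=` O x & well_covering D].

Hypothesis goodCC : good_class.

Section Lift.
Variables (A B C : sheaf X) (u : shom A B) (v : shom B C).
Hypotheses (soft_u : csoft_ker u) (exact_uv : exact_at u v).

Lemma finite_subset_chain (T : Type) (I : set T) (J : T -> set (set X)) (J0 : set (set X)) t0 :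
  I t0 -> (forall s t, I s -> I t -> J s `<=` J t \/ J t `<=` J s) ->
  finite_set J0 -> J0 `<=` \bigcup_(t in I) J t -> exists2 t, I t & J0 `<=` J t.
Proof.
move=> It0 tot /finite_seqP[s ->]; elim: s => [|V s IH] sub; first by exists t0.
have [|t It st] := IH; first by move=> W sW; apply: sub; rewrite /= in_cons sW orbT.
have [|t' It' tV] := sub V; first by rewrite /= mem_head.
have [tt'|t't] := tot _ _ It It'.
  exists t' => // W; rewrite /= in_cons => /orP[/eqP->//|sW]; apply: tt'; exact: st.
by exists t => // W; rewrite /= in_cons => /orP[/eqP->|sW]; [exact: t't|exact: st].
Qed.

(** Exactness gives lifts on the members of a cover [D] of [M]. By Zorn's lemma there is a maximal
    subfamily [J] of [D] with a lift over its union, and softness of the kernel of [u] allows one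
    more member to be added. *)
Lemma lift_section (M : set X) (p : X -> lsec B) :
  CC M -> is_section M p -> (forall x, M x -> eqnear x (lmap v (p x)) lzero) ->
  exists b, is_section M b /\ forall x, M x -> eqnear x (lmap u (b x)) (p x).
Proof.
move=> CM pM vp; have [CI Ccov] := goodCC.
have /choice[r rP] x : exists r : lsec A, M x -> oset (ldom r) x /\
    forall z, M z -> oset (ldom r) z -> eqnear z (lmap u r) (p z).
  have [Mx|nMx] := pselect (M x); last by exists lzero.
  have [O [Ox Op Oz]] := pM x Mx.
  have /eqnear_zeroP[W [h [Wx vpW]]] := vp x Mx.
  have pW : v _ (res B h (projT2 (p x))) = 0 by rewrite shom_res.
  have [V [hV [t [Vx tE]]]] := (exact_uv _).1 pW x Wx.
  exists (lmk (res A (@opensIl _ V O) t)) => _; split=> // z Mz [Vz Wz].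
  apply: (eqnear_trans (eqnear_map u (eqnear_res (@opensIl _ V O) t (conj Vz Wz)))).
  apply: eqnear_trans _ (eqnear_sym (Oz z Mz Wz)).
  rewrite /lmap /= tE; apply: (eqnear_trans (eqnear_res _ _ Vz)).
  exact: eqnear_lres (hV _ Vz).
have [D [DM DC Dr Dcov]] := Ccov M (fun x => ldom (r x)) CM (fun x Mx => (rP x Mx).1).
pose bU (J : set (set X)) := \bigcup_(V in J) V.
pose isT (t : set (set X) * (X -> lsec A)) := [/\ t.1 `<=` D, is_section (bU t.1) t.2 &
  forall x, bU t.1 x -> eqnear x (lmap u (t.2 x)) (p x)].
pose T := {t | isT t}.
(* An extension keeps the same local sections, not merely the same germs, so the union of a chain
   has a well-defined lift. *)
pose R (s t : T) := `[< (sval s).1 `<=` (sval t).1 /\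
  forall x, bU (sval s).1 x -> (sval t).2 x = (sval s).2 x >].
have T0 : T.
  by exists (set0, fun=> lzero); split=> // x [V].
have [||Ch Ctot|[[J b] [/= JD bJ ub]] Jmax] := @ZL_preorder T T0 R.
- by move=> t; apply/asboolP; split.
- move=> s t w /asboolP[st stE] /asboolP[tw twE]; apply/asboolP.
  split; first exact: subset_trans st tw.
  move=> x sx; rewrite twE ?stE //; case: sx => V sV Vx; exists V => //; exact: st.
- pose JA := \bigcup_(t in Ch) (sval t).1.
  pose bA x := if pselect (exists t, Ch t /\ bU (sval t).1 x) is left e
    then (sval (sval (cid e))).2 x else lzero.
  have bAE t x : Ch t -> bU (sval t).1 x -> bA x = (sval t).2 x.
    move=> Ct tx; rewrite /bA; case: pselect => [e|[]]; last by exists t.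
    case: (cid e) => s [Cs sx] /=.
    by case: (Ctot _ _ Cs Ct) => /asboolP[_ E]; [rewrite E|rewrite (E _ tx)].
  have bUA x : bU JA x -> exists2 t, Ch t & bU (sval t).1 x.
    by move=> [V [t Ct tV] Vx]; exists t => //; exists V.
  have JAD : JA `<=` D.
    by move=> V [t _ tV]; case: (svalP t) => /(_ _ tV).
  have TA : isT (JA, bA).
    split=> //= x xA; last first.
      have [t Ct tx] := bUA x xA; rewrite (bAE t) //.
      by case: (svalP t) => _ _; exact.
    (* Near [x] finitely many members of [JA] suffice. They all belong to one element of the chain,
       whose lift is already a section. *)
    have [J0 [finJ0 J0A J0x [O Ox OJ0]]] := Dcov JA x JAD xA.
    have [t0 Ct0 _] := bUA x xA.
    have [|t Ct J0t] := @finite_subset_chain _ Ch (fun t => (sval t).1) J0 t0 Ct0 _ finJ0 J0A.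
      by move=> s t Cs Ct; case: (Ctot s t Cs Ct) => /asboolP[]; [left|right].
    have OA z : oset O z -> bU JA z -> bU (sval t).1 z.
      by move=> Oz zA; have [V /J0t tV Vz] := OJ0 z Oz zA; exists V.
    have [_ tsec _] := svalP t.
    have [O' [Ox' O'd O'E]] := tsec x (OA x Ox xA).
    exists (opensI O O'); split=> // [z []|z zA [Oz Oz']].
      by rewrite (bAE t) => //; [move=> _; exact: O'd|exact: OA].
    by rewrite !(bAE t) //; [apply: O'E => //; exact: OA|exact: OA|exact: OA].
  exists (exist _ _ TA) => s Cs; apply/asboolP; split=> [V sV|x sx] /=; first by exists s.
  exact: bAE.
suff DJ : D `<=` J.
  have JE : J = D by apply/seteqP.
  by exists b; move: (bJ) (ub); rewrite JE /bU DM.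
move=> V DV; apply: contrapT => nJV.
have [c Mc Vc] := Dr V DV.
have VM : V `<=` M by rewrite -DM => x Vx; exists V.
have JM : bU J `<=` M by rewrite -DM => x [W /JD DW Wx]; exists W.
have CV : CC V.
  have := DC [set V]; rewrite bigcup_set1; apply; by move=> _ ->.
pose N := bU J `&` V.
have CN : CC N by apply: CI => //; exact: DC.
have rVx x : V x -> oset (ldom (r c)) x by move=> /Vc.
have urV x : V x -> eqnear x (lmap u (r c)) (p x).
  by move=> Vx; apply: (rP c Mc).2; [exact: VM|exact: rVx].
(* On the overlap with [V] the two lifts differ by a section killed by [u]. Softness makes it
   global, and adding it to the lift on [V] makes the two agree on the overlap. *)
have [a ua aN] : exists2 a : gsec A, u _ a = 0 &
    forall x, N x -> eqnear x (lmk a) (lsub (b x) (r c)).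
  apply: soft_u (CN) _ _.
    apply: is_section_lsub; first by apply: is_section_sub (bJ) => x [].
    by apply: is_section_cst => x [_ /rVx].
  move=> x [Jx Vx]; rewrite lmap_sub; apply: eqnear_subr0.
  exact: eqnear_trans (ub x Jx) (eqnear_sym (urV x Vx)).
pose r' := ladd (lmk a) (r c).
have rb x : N x -> eqnear x r' (b x) by move=> /aN; exact: eqnear_addl.
have r'x x : V x -> oset (ldom r') x by move=> /rVx.
have ur' x : V x -> eqnear x (lmap u r') (p x).
  move=> Vx; apply: eqnear_trans (urV x Vx).
  rewrite lmap_add; apply: eqnear_addl.
  rewrite [lmap u (lmk a)](_ : _ = lzero); last by rewrite /lmap /= ua.
  by apply: eqnear_sym; apply: eqnear_subr0; apply: eqnear_refl; exact: rVx.
pose b' x := if pselect (bU J x) is left _ then b x else r'.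
have b'J x : bU J x -> b' x = b x by rewrite /b'; case: pselect.
have b'V x : V x -> eqnear x (b' x) r'.
  rewrite /b' => Vx; case: pselect => Jx; last by apply: eqnear_refl; exact: r'x.
  by apply: eqnear_sym; exact: rb.
have bUJ x : bU (J `|` [set V]) x -> bU J x \/ V x.
  by move=> [W [JW|->] Wx]; [left; exists W|right].
have J'D : J `|` [set V] `<=` D by move=> W [/JD//|->].
have T' : isT (J `|` [set V], b').
  split=> //= x xJ'; last first.
    have [Jx|nJx] := pselect (bU J x); first by rewrite b'J //; exact: (ub x Jx).
    have Vx : V x by case: (bUJ x xJ').
    exact: eqnear_trans (eqnear_map u (b'V x Vx)) (ur' x Vx).
  have [J0 [finJ0 J0J' J0x [O Ox OJ0]]] := Dcov _ x J'D xJ'.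
  have [Jx|nJx] := pselect (bU J x).
    have [O2 [O2x O2d O2E]] := bJ x Jx.
    rewrite b'J //; have [Vx|nVx] := pselect (V x).
      have [O1 O1x O1E] := eqnear_nbhs (rb x (conj Jx Vx)).
      exists (opensI O1 O2); split=> // [z [_ /O2d]//|z zJ' [O1z O2z]].
      have [Jz|nJz] := pselect (bU J z); first by rewrite b'J //; exact: O2E.
      have Vz : V z by case: (bUJ z zJ').
      exact: eqnear_trans (b'V z Vz) (O1E z O1z).
    (* Here [x] is outside [V]. The members that suffice near [x] all contain [x], so none of them
       is [V], and nearby points stay in the union of [J]. *)
    exists (opensI O O2); split=> // [z [_ /O2d]//|z zJ' [Oz O2z]].
    have Jz : bU J z.
      have [W J0W Wz] := OJ0 z Oz zJ'; exists W => //.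
      by case: (J0J' W J0W) => // WV; case: nVx; rewrite -WV; exact: J0x.
    by rewrite b'J //; exact: O2E.
  have Vx : V x by case: (bUJ x xJ').
  have b'x : b' x = r' by rewrite /b'; case: pselect.
  exists (opensI O (ldom r')); rewrite b'x; split; first by split=> //; exact: r'x.
    by move=> z [].
  move=> z zJ' [Oz _]; apply: b'V.
  have [W J0W Wz] := OJ0 z Oz zJ'.
  case: (J0J' W J0W) => [JW|<-//].
  by case: nJx; exists W => //; exact: J0x.
have /asboolP[J'J _] : R (exist _ _ T') (exist isT (J, b) (And3 JD bJ ub)).
  by apply: Jmax; apply/asboolP; split=> [W JW|]; [left|exact: b'J].
by apply: nJV; apply: J'J; right.
Qed.

(** The induction step along the complex: a section of the kernel of [v] over [M] lifts to [A],
    extends there to a global section, and is mapped back by [u]. *)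
Lemma csoft_ker_next : csoft A -> csoft_ker v.
Proof.
move=> softA M p CM pM vp; have [b [bM ub]] := lift_section CM pM vp.
have [t tb] := softA M b CM bM; exists (u _ t).
  by apply/exact_uv => x Tx; exists (opensT X), (@subset_refl _ _), t; rewrite res_id.
by move=> x Mx; exact: eqnear_trans (eqnear_map u (tb x Mx)) (ub x Mx).
Qed.

(** The lift is given only by germs, and it glues because [W] is open. For the class of closed sets
    this is applied to the whole space. *)
Lemma exact_sections (W : opens X) (s : B W) : CC W -> v W s = 0 -> exists t, u W t = s.
Proof.
move=> CW vs; have [||b [bW ub]] := @lift_section W (fun=> lmk s) CW.
- exact: is_section_cst.
- by move=> x Wx; apply/eqnear_zeroP; exists W, (@subset_refl _ _); rewrite /= vs raddf0.
have [t tb] := glue_section bW; exists t; apply: eqnear_eq => x Wx.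
exact: eqnear_trans (eqnear_map u (tb x Wx)) (ub x Wx).
Qed.

End Lift.

Lemma csoft_ker_mono (A B : sheaf X) (u : shom A B) : sheaf_mono u -> csoft_ker u.
Proof.
move=> mono_u M p CM pM up; exists 0; first exact: raddf0.
move=> x Mx; have /eqnear_zeroP[W [h [Wx upW]]] := up x Mx.
apply: eqnear_sym; apply/eqnear_zeroP; exists W, h; split=> //.
by apply: (mono_u W); rewrite shom_res raddf0.
Qed.

Lemma csoft_exact_sections (E : nat -> sheaf X) (d : forall q, shom (E q) (E q.+1)) :
  (forall q, csoft (E q)) -> sheaf_mono (d 0) -> (forall q, exact_at (d q) (d q.+1)) ->
  forall W : opens X, CC W ->
  forall q (s : E q.+1 W), d q.+1 W s = 0 -> exists t, d q W t = s.
Proof.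
move=> softE mono_d exact_d W CW q s ds.
have soft_d : csoft_ker (d q).
  elim: q {s ds} => [|q IH]; first exact: csoft_ker_mono.
  exact: csoft_ker_next IH (exact_d q) (softE q).
exact: (exact_sections soft_d (exact_d q)).
Qed.

End Softness.

Lemma soft_csoft (X : topologicalType) (G : sheaf X) : soft G -> csoft closed G.
Proof.
move=> softG M p cM pM.
have [|t tE] := softG M cM (fun x => germ (projT2 (p x)) x).
  move=> x Mx; have [O [Ox Op Oz]] := pM x Mx.
  exists O, (res G Op (projT2 (p x))); split=> // z Mz zO.
  have pz : eqnear z (lmk (res G Op (projT2 (p x)))) (p z).
    exact: eqnear_trans (eqnear_lres Op zO) (eqnear_sym (Oz z Mz zO)).
  apply/seteqP; split=> r zr.
    exact: (eqnear_trans pz (zr : eqnear z (p z) r)).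
  exact: (eqnear_trans (eqnear_sym pz) (zr : eqnear z (lmk _) r)).
exists t => x Mx.
have : germ (projT2 (p x)) x (p x) by apply: eqnear_refl; exact: is_section_dom pM Mx.
by rewrite tE.
Qed.

Lemma opens_good (X : topologicalType) : good_class (@open X).
Proof.
split=> [M N|M O oM MO]; first exact: openI.
exists [set V | exists2 x, M x & V = M `&` O x]; split.
- apply/seteqP; split=> [x [_ [y My ->] []]//|x Mx].
  by exists (M `&` O x); [exists x|split => //; exact: MO].
- by move=> J JD; apply: bigcup_open => V /JD[x _ ->]; apply: openI => //; exact: oset_open.
- by move=> _ [x Mx ->]; exists x => // z [].
- move=> J x JD [V JV Vx]; exists [set V]; split=> // [W -> //|W -> //|].
  have oV : open V by have [y _ ->] := JD V JV; apply: openI => //; exact: oset_open.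
  by exists (Opens oV) => // z Vz _; exists V.
Qed.

Lemma flabby_csoft_open (X : topologicalType) (G : sheaf X) : flabby G -> csoft open G.
Proof.
move=> flG M p oM pM; have [s sE] := glue_section (pM : is_section (Opens oM) p).
have [t tE] := flG _ s; exists t => x Mx; apply: eqnear_trans (sE x Mx).
by rewrite -tE; apply: eqnear_sym; exact: eqnear_res.
Qed.

(** * Paracompact spaces *)

Section Paracompact.
Variable X : topologicalType.

Lemma near_finite (T : Type) (F : set (set T)) (x : X) (P : set T -> X -> Prop) :
  finite_set F -> (forall V, F V -> \forall z \near x, P V z) ->
  \forall z \near x, forall V, F V -> P V z.
Proof.
move=> /finite_seqP[s ->]; elim: s => [|V s IH] FP.
  by apply: filterE => z V; rewrite /= in_nil.
have Ps : \forall z \near x, forall W, W \in s -> P W z.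
  by apply: IH => W sW; apply: FP; rewrite /= in_cons sW orbT.
have PV : \forall z \near x, P V z by apply: FP; rewrite /= mem_head.
near=> z => W; rewrite /= in_cons => /orP[/eqP->|]; first by near: z.
by move: W; near: z.
Unshelve. all: by end_near. Qed.

Lemma near_opens (x : X) (P : set X) :
  (\forall z \near x, P z) -> exists2 O : opens X, oset O x & O `<=` P.
Proof.
have E : (\forall z \near x, P z) = nbhs x P by [].
by rewrite E nbhsE => -[W [oW Wx] WP]; exists (Opens oW).
Qed.

Definition locally_finite (D : set (set X)) : Prop :=
  forall x : X, exists2 N, nbhs x N & finite_set [set V | D V /\ V `&` N !=set0].

Lemma locally_finite_at D x : locally_finite D -> finite_set [set V | D V /\ V x].
Proof.
move=> /(_ x)[N Nx]; apply: sub_finite_set => V [DV Vx]; split=> //.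
by exists x; split=> //; exact: nbhs_singleton.
Qed.

(** Of the finitely many members met near [x], those that avoid [x] are closed and can be avoided by
    shrinking the neighbourhood. *)
Lemma locally_finite_near D x : locally_finite D -> (forall V, D V -> closed V) ->
  \forall z \near x, forall V, D V -> V z -> V x.
Proof.
move=> lfD cD; have [N Nx finN] := lfD x.
have near_x : \forall z \near x, forall V, D V /\ V `&` N !=set0 -> V z -> V x.
  apply: near_finite finN _ => V [/cD cV _].
  have [Vx|nVx] := pselect (V x); first by apply: filterE.
  have : nbhs x (~` V) by apply: open_nbhs_nbhs; split=> //; exact: closed_openC.
  by apply: filterS => z nVz /nVz.
near=> z => V DV Vz.
have Nz : N z by near: z.
have : forall V, D V /\ V `&` N !=set0 -> V z -> V x by near: z.
by apply=> //; split=> //; exists z.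
Unshelve. all: by end_near. Qed.

Hypothesis pX : paracompact X.

(** The members of a locally finite refinement that are not contained in [U]
    cover [~` U] and stay away from [x]. *)
Lemma paracompact_regular (x : X) (U : set X) : open U -> U x ->
  exists W, [/\ open W, W x & closure W `<=` U].
Proof.
move=> oU Ux; have [hX parX] := pX.
pose far (B : set X) := exists A, [/\ open A, A x & A `&` B = set0].
have [||D [oD covD refD lfD]] := parX [set B | open B /\ (far B \/ B = U)].
- by move=> B [].
- rewrite -subTset => y _; have [Uy|nUy] := pselect (U y).
    by exists U => //; split=> //; right.
  have xy : x != y by apply/eqP => xy; apply: nUy; rewrite -xy.
  move: hX; rewrite open_hausdorff => /(_ x y xy)[[A B] /= [Ax By] [oA oB AB]].
  exists B; last by rewrite inE in By.
  split=> //; left; exists A; split=> //; first by rewrite inE in Ax.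
  exact/eqP.
have [N Nx finN] := lfD x.
pose F : set (set X) := [set V | D V /\ V `&` N !=set0].
have nearF : \forall z \near x, forall V, F V -> ~ V `<=` U -> ~ V z.
  apply: near_finite finN _ => V [DV _]; have [B [oB [[A [oA Ax AB]]|->]] VB] := refD V DV.
    have : nbhs x A by exact: open_nbhs_nbhs.
    apply: filterS => z Az _ Vz; suff : (A `&` B) z by rewrite AB.
    by split=> //; exact: VB.
  by apply: filterE => z /(_ VB).
have : nbhs x [set z | N z /\ forall V, F V -> ~ V `<=` U -> ~ V z].
  by near=> z; split; near: z.
rewrite nbhsE => -[W [oW Wx] WN]; exists W; split=> // z Wz.
apply: contrapT => nUz.
have [V DV Vz] : (\bigcup_(V in D) V) z by rewrite covD.
have VU : ~ V `<=` U by move=> /(_ _ Vz).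
have Vnbhs : nbhs z V by apply: open_nbhs_nbhs; split=> //; exact: oD.
have [y [Wy Vy]] := Wz V Vnbhs.
have [Ny /(_ V)] := WN y Wy; apply=> //.
by split=> //; exists y.
Unshelve. all: by end_near. Qed.

(** By regularity the cover is first refined to open sets whose closures still lie in members of
    [C]; the closures of a locally finite refinement of these do the job. *)
Lemma closed_refinement (C : set (set X)) :
  (forall U, C U -> open U) -> \bigcup_(U in C) U = setT ->
  exists D : set (set X), [/\ forall V, D V -> closed V, \bigcup_(V in D) V = setT,
    forall V, D V -> exists2 U, C U & V `<=` U & locally_finite D].
Proof.
move=> oC covC; have [_ parX] := pX.
have [||D [oD covD refD lfD]] := parX [set W | open W /\ exists2 U, C U & closure W `<=` U].
- by move=> W [].
- rewrite -subTset => x _; have [U CU Ux] : (\bigcup_(U in C) U) x by rewrite covC.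
  have [W [oW Wx WU]] := paracompact_regular (oC U CU) Ux.
  by exists W => //; split=> //; exists U.
exists (@closure X @` D); split.
- by move=> _ [V _ <-]; exact: closed_closure.
- rewrite -subTset => x _; have [V DV Vx] : (\bigcup_(V in D) V) x by rewrite covD.
  by exists (closure V); [exists V|exact: subset_closure].
- move=> _ [V /refD[W [_ [U CU WU]] VW] <-]; exists U => //.
  exact: subset_trans (closureS VW) WU.
(* The interior is taken because an open set that meets [closure V] meets [V]. *)
- move=> x; have [N Nx finN] := lfD x; exists (interior N).
    exact: nbhs_interior.
  apply: sub_finite_set (finite_image (@closure X) finN) => _ [[V DV <-] [z [Vz Nz]]].
  exists V => //; split=> //; have [y [Vy Ny]] := Vz _ Nz.
  by exists y.
Qed.

Lemma closed_good : good_class (@closed X).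
Proof.
split=> [M N|M O cM MO]; first exact: closedI.
have [||D0 [cD0 covD0 refD0 lfD0]] :=
    @closed_refinement [set U : set X | (exists2 x, M x & U = oset (O x)) \/ U = ~` M].
- by move=> U [[x _ ->]|->]; [exact: oset_open|exact: closed_openC].
- rewrite -subTset => x _; have [Mx|nMx] := pselect (M x); last by exists (~` M) => //; right.
  by exists (O x); [left; exists x|exact: MO].
(* Members of [D0] not contained in any [O x] lie in the complement of [M], so dropping them still
   leaves a cover of [M]. *)
pose D : set (set X) := [set V `&` M | V in [set V | D0 V /\ exists2 x, M x & V `<=` O x]].
have cD V : D V -> closed V by move=> [W [DW _] <-]; apply: closedI => //; exact: cD0.
have lfD : locally_finite D.
  move=> x; have [N Nx finN] := lfD0 x; exists N => //.
  apply: sub_finite_set (finite_image (fun V => V `&` M) finN).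
  move=> _ [[V [DV _] <-] [z [[Vz _] Nz]]]; exists V => //; split=> //.
  by exists z.
have lfJ J : J `<=` D -> locally_finite J.
  move=> JD x; have [N Nx finN] := lfD x; exists N => //.
  by apply: sub_finite_set finN => V [/JD].
exists D; split.
- apply/seteqP; split=> [x [_ [V _ <-]] []//|x Mx].
  have [V DV Vx] : (\bigcup_(V in D0) V) x by rewrite covD0.
  exists (V `&` M) => //; exists V => //; split=> //.
  have [_ [[y My ->]|->] VU] := refD0 V DV; first by exists y.
  by have := VU x Vx.
- move=> J JD; rewrite -[X in closed X]setCK; apply: open_closedC.
  rewrite openE => x nJx.
  have := locally_finite_near x (lfJ J JD) (fun V JV => cD V (JD V JV)).
  apply: filterS => z zJ [V JV Vz]; apply: nJx; exists V => //; exact: zJ.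
- by move=> _ [V [_ [x Mx VO]] <-]; exists x => // z [/VO].
- move=> J x JD xJ; exists [set V | J V /\ V x]; split.
  + exact: locally_finite_at (lfJ J JD).
  + by move=> V [].
  + by move=> V [].
  + have [W Wx WJ] := near_opens
      (locally_finite_near x (lfJ J JD) (fun V JV => cD V (JD V JV))).
    exists W => // z /WJ zJ [V JV Vz].
    by exists V => //; split=> //; exact: zJ.
Qed.

(** [N] consists of the points where the local sections attached to the members of
    a locally finite closed cover have the same germ; it is an open neighbourhood of [M]. *)
Lemma flabby_csoft_closed (G : sheaf X) : flabby G -> csoft closed G.
Proof.
move=> flG M p cM pM.
have /choice[O OP] x : exists O : opens X, M x ->
    [/\ oset O x, O `<=` ldom (p x) & forall z, M z -> oset O z -> eqnear z (p z) (p x)].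
  have [/pM[O OP]|nMx] := pselect (M x); first by exists O.
  by exists (opensT X).
have [||D [cD covD refD lfD]] :=
    @closed_refinement [set U : set X | (exists2 x, M x & U = oset (O x)) \/ U = ~` M].
- by move=> U [[x _ ->]|->]; [exact: oset_open|exact: closed_openC].
- rewrite -subTset => x _; have [Mx|nMx] := pselect (M x); last by exists (~` M) => //; right.
  by exists (O x); [left; exists x|have [] := OP x Mx].
have /choice[c cP] V : exists r : lsec G, D V ->
    V `<=` ldom r /\ forall z, M z -> V z -> eqnear z (p z) r.
  have [DV|nDV] := pselect (D V); last by exists lzero.
  have [_ [[x Mx ->]|->] VU] := refD V DV.
    have [_ Op Oz] := OP x Mx; exists (p x) => _; split; first exact: subset_trans VU Op.
    by move=> z Mz /VU; exact: Oz.
  by exists lzero => _; split=> // z Mz /VU.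
pose N : set X := [set z | forall V V', D V -> D V' -> V z -> V' z -> eqnear z (c V) (c V')].
(* Near [z] only members through [z] occur. There are finitely many pairs of them, so equality of
   their germs at [z] spreads to one common neighbourhood. *)
have ccN z : N z -> \forall y \near z, forall V V', D V -> D V' -> V y ->
    V z /\ (V' z -> eqnear y (c V) (c V')).
  move=> Nz; have finz := locally_finite_at z lfD.
  have nearV : \forall y \near z, forall V, D V /\ V z -> forall V', D V' /\ V' z ->
      eqnear y (c V) (c V').
    apply: near_finite (finz) _ => V [DV Vz]; apply: near_finite (finz) _ => V' [DV' Vz'].
    have [W Wz WE] := eqnear_nbhs (Nz V V' DV DV' Vz Vz').
    have : nbhs z W by apply: open_nbhs_nbhs; split=> //; exact: oset_open.
    by apply: filterS.
  have nearz := locally_finite_near z lfD cD.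
  near=> y => V V' DV DV' Vy.
  have yz : forall V, D V -> V y -> V z by near: y.
  have yE : forall V, D V /\ V z -> forall V', D V' /\ V' z -> eqnear y (c V) (c V').
    by near: y.
  have Vz := yz V DV Vy; split=> // Vz'; exact: yE.
have oN : open N.
  rewrite openE => z /ccN; apply: filterS => y yN V V' DV DV' Vy Vy'.
  by apply: (yN V V' DV DV' Vy).2; exact: (yN V' V' DV' DV' Vy').1.
have covz z : exists V, D V /\ V z.
  by have [V DV Vz] : (\bigcup_(V in D) V) z by [rewrite covD]; exists V.
have /choice[k kP] := covz.
have kN : is_section (Opens oN) (fun z => c (k z)).
  move=> z Nz; have [W Wz WN] := near_opens (ccN z Nz).
  have [DV Vz] := kP z.
  exists (opensI W (ldom (c (k z)))); split=> [|y []//|y Ny [Wy _]].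
    by split=> //; exact: (cP _ DV).1.
  have [DV' Vy'] := kP y.
  exact: (WN y Wy _ _ DV' DV Vy').2.
have MN z : M z -> N z.
  move=> Mz V V' DV DV' Vz Vz'; have [_ cV] := cP V DV; have [_ cV'] := cP V' DV'.
  exact: eqnear_trans (eqnear_sym (cV z Mz Vz)) (cV' z Mz Vz').
have [s sE] := glue_section kN; have [t tE] := flG _ s; exists t => x Mx.
have : eqnear x (lmk t) (lmk s).
  by rewrite -tE; apply: eqnear_sym; apply: eqnear_res; exact: MN.
move=> /eqnear_trans; apply; apply: (eqnear_trans (sE x (MN x Mx))).
by have [DV Vx] := kP x; apply: eqnear_sym; exact: (cP _ DV).2.
Unshelve. all: by end_near. Qed.

End Paracompact.

(** * Cones of morphisms of resolutions *)

Section DirectSum.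
Variables (X : topologicalType) (A B : sheaf X).

Definition dsum_sec (U : opens X) : zmodType := (A U * B U)%type.
Definition dsum_res (U V : opens X) (h : V `<=` U) (s : dsum_sec U) : dsum_sec V :=
  (res A h s.1, res B h s.2).
Lemma dsum_res_additive U V h : zmod_morphism (@dsum_res U V h).
Proof. by move=> s t; congr pair; rewrite raddfB. Qed.
HB.instance Definition _ U V h :=
  GRing.isZmodMorphism.Build _ _ (@dsum_res U V h) (@dsum_res_additive U V h).

Definition dsum : sheaf X.
Proof.
apply: (@Sheaf X dsum_sec (fun U V h => @dsum_res U V h)).
- by move=> U h [a b]; rewrite /= /dsum_res !res_id.
- by move=> *; congr pair; exact: res_comp.
- move=> U I C hC cov [a b] [a' b'] st; congr pair.
    by apply: sheaf_locality cov _ _ _ => i; have /(congr1 fst) := st i.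
  by apply: sheaf_locality cov _ _ _ => i; have /(congr1 snd) := st i.
- move=> U I C hC cov s sC.
  have [a aE] : exists a, forall i, res A (hC i) a = (s i).1.
    apply: (sheaf_gluing hC cov) => i j W hi hj.
    by have /(congr1 fst) := sC i j W hi hj.
  have [b bE] : exists b, forall i, res B (hC i) b = (s i).2.
    apply: (sheaf_gluing hC cov) => i j W hi hj.
    by have /(congr1 snd) := sC i j W hi hj.
  by exists (a, b) => i; rewrite /= /dsum_res aE bE -surjective_pairing.
Defined.

Lemma csoft_dsum (CC : set (set X)) : csoft CC A -> csoft CC B -> csoft CC dsum.
Proof.
move=> softA softB M p CM pM.
have fstP x (r t : lsec dsum) : eqnear x r t ->
    eqnear x (lmk (projT2 r).1) (lmk (projT2 t).1).
  move=> [W [hr [ht [Wx /(congr1 fst) rt]]]]; by exists W, hr, ht.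
have sndP x (r t : lsec dsum) : eqnear x r t ->
    eqnear x (lmk (projT2 r).2) (lmk (projT2 t).2).
  move=> [W [hr [ht [Wx /(congr1 snd) rt]]]]; by exists W, hr, ht.
have [|a aE] := softA M (fun x => lmk (projT2 (p x)).1) CM.
  move=> x /pM[O [Ox Op Oz]]; exists O; split=> // z Mz zO.
  exact: (fstP _ _ _ (Oz z Mz zO)).
have [|b bE] := softB M (fun x => lmk (projT2 (p x)).2) CM.
  move=> x /pM[O [Ox Op Oz]]; exists O; split=> // z Mz zO.
  exact: (sndP _ _ _ (Oz z Mz zO)).
exists (a, b) => x Mx.
have [W [hT [hp [Wx aW]]]] := aE x Mx; have [W' [hT' [hp' [Wx' bW]]]] := bE x Mx.
pose V := opensI W W'.
have kp : V `<=` ldom (p x) by move=> z [/hp].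
exists V, (sub_opensT V), kp; split=> //; congr pair => /=.
  rewrite -(res_comp hT (@opensIl _ W W')) -(res_comp hp (@opensIl _ W W')).
  by rewrite [res A hT _]aW.
rewrite -(res_comp hT' (@opensIr _ W W')) -(res_comp hp' (@opensIr _ W W')).
by rewrite [res B hT' _]bW.
Qed.

End DirectSum.

Lemma csoft_iso (X : topologicalType) (CC : set (set X)) (G H : sheaf X) (w : shom G H) :
  (forall U, bijective (w U)) -> csoft CC H -> csoft CC G.
Proof.
move=> bij_w softH M p CM pM.
have [|t tE] := softH M (fun x => lmap w (p x)) CM.
  move=> x /pM[O [Ox Op Oz]]; exists O; split=> // z Mz zO.
  exact: eqnear_map (Oz z Mz zO).
have [v vK wK] := bij_w (opensT X).
exists (v t) => x Mx; have [W [hT [hp [Wx tW]]]] := tE x Mx.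
exists W, hT, hp; split=> //; apply: (bij_inj (bij_w W)).
by rewrite !shom_res -[RHS]tW /= wK.
Qed.

Section ConeSheaf.
Variables (X : topologicalType) (A : sheaf X) (K J : augcplx A) (u : augmap K J).

Definition cone_sheaf (q : nat) : sheaf X :=
  if q is q'.+1 then dsum (K q'.+1) (J q') else K 0.

Lemma cone_sheaf_diff_res0 (U V : opens X) (h : V `<=` U) (s : K 0 U) :
  cdiff (cone (seccplx_map u V)) 0 (res (K 0) h s) =
  res (dsum (K 1) (J 0)) h (cdiff (cone (seccplx_map u U)) 0 s).
Proof. by rewrite /= /dsum_res /= !shom_res. Qed.

Lemma cone_sheaf_diff_resS q (U V : opens X) (h : V `<=` U) (s : dsum (K q.+1) (J q) U) :
  cdiff (cone (seccplx_map u V)) q.+1 (res (dsum (K q.+1) (J q)) h s) =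
  res (dsum (K q.+2) (J q.+1)) h (cdiff (cone (seccplx_map u U)) q.+1 s).
Proof. by rewrite /= /dsum_res /= !shom_res raddfB. Qed.

Definition cone_sheaf_diff (q : nat) : shom (cone_sheaf q) (cone_sheaf q.+1) :=
  match q return shom (cone_sheaf q) (cone_sheaf q.+1) with
  | 0 => @SHom _ (K 0) (dsum (K 1) (J 0))
           (fun U => cdiff (cone (seccplx_map u U)) 0) cone_sheaf_diff_res0
  | q'.+1 => @SHom _ (dsum (K q'.+1) (J q')) (dsum (K q'.+2) (J q'.+1))
           (fun U => cdiff (cone (seccplx_map u U)) q'.+1) (@cone_sheaf_diff_resS q')
  end.

Lemma acyclic_cone_sections (U : opens X) :
  injective (cone_sheaf_diff 0 U) ->
  (forall q (s : cone_sheaf q.+1 U), cone_sheaf_diff q.+1 U s = 0 ->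
     exists t, cone_sheaf_diff q U t = s) ->
  acyclic (cone (seccplx_map u U)).
Proof.
move=> inj0 ex [|q] x dx.
  by apply: inj0; rewrite raddf0; exact: dx.
have [t tE] := ex q x dx; case: q x t tE {dx} => [|q] x t tE; by exists t.
Qed.

Hypotheses (resK : is_resolution K) (resJ : is_resolution J).

(** A section in the kernel locally comes from a section [a] of [A]. Since [u] respects the
    augmentations, [a] dies in [J 0], where [A] embeds. *)
Lemma cone_sheaf_mono : sheaf_mono (cone_sheaf_diff 0).
Proof.
have [monoK exK0 exK] := resK; have [monoJ _ _] := resJ.
move=> U s t /eqP; rewrite -subr_eq0 -raddfB => /eqP[].
set r := s - t => dr ur; apply/eqP; rewrite -subr_eq0 -/r; apply/eqP.
apply: section_eq0 => x Ux; have [V [h [a [Vx aE]]]] := (exK0 U r).1 dr x Ux.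
exists V, h; split=> //; rewrite -aE [a](_ : _ = 0) ?raddf0 //.
by apply: (monoJ V); rewrite raddf0 -(augmap_aug u) aE shom_res ur raddf0.
Qed.

Lemma cone_sheaf_exact q : exact_at (cone_sheaf_diff q) (cone_sheaf_diff q.+1).
Proof.
have [monoK exK0 exK] := resK; have [monoJ exJ0 exJ] := resJ.
have dd U s : cone_sheaf_diff q.+1 U (cone_sheaf_diff q U s) = 0.
  by case: q s => [|q'] s; exact: (cdiffK (c := cone (seccplx_map u U))).
move=> U s; split; last first.
  move=> sloc; apply: section_eq0 => x /sloc[V [h [t [Vx tE]]]].
  by exists V, h; rewrite -shom_res -tE dd.
case: s => k j [dk ukj] x Ux.
have uk := subr0_eq ukj.
have [V [h [k1 [Vx k1E]]]] := (exK q U k).1 dk x Ux.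
have [V' [h' [s' [Vx' s'E]]]] : exists (V' : opens X) (h' : V' `<=` V) (t : cone_sheaf q V'),
    oset V' x /\ cone_sheaf_diff q V' t =
      res (dsum (K q.+1) (J q)) h' (res (K q.+1) h k, res (J q) h j).
  have dj : shdiff J q V (res (J q) h j - u q V k1) = 0.
    by rewrite raddfB shom_res -augmap_diff k1E shom_res [u _ _ _]uk subrr.
  (* [j - u k1] is a cycle of [J]. In positive degree a local primitive corrects the second
     component; in degree 0 it comes from a section of [A], which is added to [k1] through [aug K]
     without changing the differential of [k1]. *)
  case: q {dd} k j k1 dk ukj uk k1E dj => [|q] k j k1 dk ukj uk k1E dj.
    have [V' [h' [a [Vx' aE]]]] := (exJ0 V _).1 dj x Vx.
    exists V', h', (res (K 0) h' k1 + aug K V' a); split=> //=.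
    rewrite /dsum_res /= -k1E !raddfD /= shom_res aug_diff addr0.
    by rewrite augmap_aug aE raddfB shom_res addrC subrK.
  have [V' [h' [j1 [Vx' j1E]]]] := (exJ q V _).1 dj x Vx.
  exists V', h', (res (K q.+1) h' k1, - j1); split=> //=.
  by rewrite /dsum_res /= -k1E !shom_res raddfN opprK j1E raddfB addrC subrK.
have k' : V' `<=` U by move=> z /h'/h.
exists V', k', s'; split=> //; rewrite s'E /= /dsum_res /=.
by rewrite (res_comp _ _ k') (res_comp _ _ k').
Qed.

End ConeSheaf.

(** A map [e : X -> Z] such that every open set [U] of [X] has a smallest open
    neighbourhood [trm U] of [e(U)], so that the inverse image along [e] needs
    no sheafification. *)
Record transfer (X Z : topologicalType) := Transfer {
  tre : X -> Z;
  trm :> opens X -> opens Z;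
  trm_mono : forall U V : opens X, V `<=` U -> trm V `<=` trm U;
  trm_cover : forall (U : opens X) (I : Type) (C : I -> opens X),
    U `<=` \bigcup_i C i -> trm U `<=` \bigcup_i trm (C i);
  trm_cap : forall U V : opens X, trm U `&` trm V `<=` trm (opensI U V);
  tre_in : forall (U : opens X) x, oset U x -> oset (trm U) (tre x);
  trm_min : forall (W : opens Z) x, oset W (tre x) ->
    exists2 V : opens X, oset V x & trm V `<=` W }.

Arguments trm_mono {X Z} m {U V} h : rename.
Arguments trm_cover {X Z} m {U I C} : rename.
Arguments tre_in {X Z} m {U x} : rename.
Arguments trm_min {X Z} m {W x} : rename.

Section Transfer.
Variables (X Z : topologicalType) (m : transfer X Z).

Definition pull (G : sheaf Z) : sheaf X.
Proof.
apply: (@Sheaf X (fun U => G (m U)) (fun U V h => res G (trm_mono m h))).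
- by move=> *; apply: res_id.
- by move=> *; apply: res_comp.
- move=> U I C hC cov s t.
  exact: (@sheaf_locality _ G _ _ _ (fun i => trm_mono m (hC i)) (trm_cover m cov)).
- move=> U I C hC cov s sC.
  apply: (@sheaf_gluing _ G _ _ _ (fun i => trm_mono m (hC i))
    (trm_cover m cov)) => i j W hi hj.
  have hW : W `<=` m (opensI (C i) (C j)).
    by move=> z Wz; apply: trm_cap; split; [exact: hi|exact: hj].
  have := sC i j (opensI (C i) (C j)) (@opensIl _ _ _) (@opensIr _ _ _).
  move=> /(congr1 (res G hW)).
  by rewrite (res_comp _ _ hi) (res_comp _ _ hj).
Defined.

Lemma pull_flabby (G : sheaf Z) : flabby G -> flabby (pull G).
Proof.
move=> flG U s; have [t tE] := flG (m U) s.
exists (res G (sub_opensT _) t).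
by rewrite -tE; exact: (@res_comp _ G).
Qed.

Definition pull_shom (G H : sheaf Z) (u : shom G H) : shom (pull G) (pull H) :=
  @SHom X (pull G) (pull H) (fun U => u (m U)) (fun U V h s => shom_res u (trm_mono m h) s).

Lemma pull_exact (A B C : sheaf Z) (u : shom A B) (v : shom B C) :
  exact_at u v -> exact_at (pull_shom u) (pull_shom v).
Proof.
move=> uv; have vu W t : v W (u W t) = 0.
  by apply/uv => x Wx; exists W, (@subset_refl _ _), t; rewrite res_id.
move=> U s; split=> [/uv sloc x Ux|sloc]; last first.
  apply: (@section_eq0 _ (pull C)) => x /sloc[V [h [t [Vx tE]]]].
  by exists V, h; split=> //; rewrite -shom_res -tE /= vu.
have [W [h [t [Wx tE]]]] := sloc _ (tre_in m Ux).
have [V Vx VW] := trm_min m Wx.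
have kW : m (opensI U V) `<=` W by move=> z /(trm_mono m (@opensIr _ U V))/VW.
exists (opensI U V), (@opensIl _ U V), (res A kW t); split=> //=.
by rewrite shom_res tE; exact: (@res_comp _ B).
Qed.

Lemma pull_mono (A B : sheaf Z) (u : shom A B) : sheaf_mono u -> sheaf_mono (pull_shom u).
Proof. by move=> mono_u U; exact: mono_u. Qed.

Lemma csoft_pull_dsum (CC : set (set X)) (A B : sheaf Z) :
  csoft CC (pull A) -> csoft CC (pull B) -> csoft CC (pull (dsum A B)).
Proof.
move=> softA softB.
pose w : shom (pull (dsum A B)) (dsum (pull A) (pull B)) :=
  @SHom X (pull (dsum A B)) (dsum (pull A) (pull B)) (fun U => idfun) (fun U V h s => erefl).
by apply: (@csoft_iso _ _ _ _ w); [move=> U; exists id|exact: csoft_dsum].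
Qed.

(** The terms of the cone are [K 0] and direct sums, hence soft after pulling back, and sections of
    the pulled-back cone over [U] are its sections over [m U]. *)
Lemma acyclic_cone_pull (CC : set (set X)) (A : sheaf Z) (K J : augcplx A)
    (u : augmap K J) (U : opens X) :
  good_class CC -> CC U -> is_resolution K -> is_resolution J ->
  (forall q, csoft CC (pull (K q))) -> (forall q, csoft CC (pull (J q))) ->
  acyclic (cone (seccplx_map u (m U))).
Proof.
move=> goodCC CU resK resJ softK softJ.
apply: acyclic_cone_sections; first exact: (@cone_sheaf_mono _ _ _ _ u resK resJ (m U)).
have softE q : csoft CC (pull (cone_sheaf K J q)).
  by case: q => [|q]; [exact: softK|exact: csoft_pull_dsum].
have monoE : sheaf_mono (pull_shom (cone_sheaf_diff u 0)).
  by apply: pull_mono; exact: cone_sheaf_mono.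
have exE q : exact_at (pull_shom (cone_sheaf_diff u q)) (pull_shom (cone_sheaf_diff u q.+1)).
  by apply: pull_exact; exact: cone_sheaf_exact.
exact: (@csoft_exact_sections _ _ goodCC _ _ softE monoE exE U CU).
Qed.

End Transfer.

Lemma acyclic_cone_flabby (X : topologicalType) (A : sheaf X) (K J : augcplx A)
    (u : augmap K J) (U : opens X) :
  is_resolution K -> is_resolution J ->
  (forall q, flabby (K q)) -> (forall q, flabby (J q)) ->
  acyclic (cone (seccplx_map u U)).
Proof.
move=> resK resJ flK flJ.
apply: acyclic_cone_sections; first exact: (@cone_sheaf_mono _ _ _ _ u resK resJ U).
have softE q : csoft open (cone_sheaf K J q).
  case: q => [|q]; first exact: flabby_csoft_open (flK 0).
  exact: csoft_dsum (flabby_csoft_open (flK _)) (flabby_csoft_open (flJ _)).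
exact: (@csoft_exact_sections _ _ (@opens_good X) _ (cone_sheaf_diff u) softE
  (@cone_sheaf_mono _ _ _ _ u resK resJ) (@cone_sheaf_exact _ _ _ _ u resK resJ)
  U (oset_open U)).
Qed.

Lemma cohom_map_bij_degreewise (A B : cochain) (u : cmap A B) q :
  (forall q, bijective (u q)) -> bijective (@cohom_map A B u q).
Proof.
move=> bij_u; apply: cohom_map_bij.
  case: q => [|q] x dx /=.
    by move=> ux; apply: (bij_inj (bij_u 0)); rewrite ux raddf0.
  move=> [y yx]; have [v vK wK] := bij_u q; exists (v y).
  by apply: (bij_inj (bij_u q.+1)); rewrite cmap_diff wK.
move=> y dy; have [v vK wK] := bij_u q; exists (v y).
  by apply: (bij_inj (bij_u q.+1)); rewrite cmap_diff wK dy raddf0.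
by rewrite wK subrr; exact: is_coboundary0.
Qed.

Lemma opens_eq (X : topologicalType) (U V : opens X) : (U : set X) = V -> U = V.
Proof.
case: U V => [U oU] [V oV] /= UV; move: oU; rewrite UV => oU.
by congr Opens; exact: Prop_irrelevance.
Qed.

(** * The mapping cylinder *)

Section CylinderTransfers.
Variables (X Y : topologicalType) (f : continuousType Y X).

Lemma opens_tildeT : opens_tilde f (opensT X) = opensT (cylinder f).
Proof.
apply: opens_eq; rewrite -subTset => -[x|y] _; first by apply/tilde_inl.
by apply/tilde_inr.
Qed.

Lemma opens_inrT : opens_inr f (opensT Y) = cyl_compl f.
Proof.
apply: opens_eq; apply/seteqP; split=> [_ [y _ <-] [x _ //]|[x []|y _]]; first by exists x.
by exists y.
Qed.

Definition tilde_transfer : transfer X (cylinder f).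
Proof.
apply: (@Transfer X (cylinder f) (@cinl _ _ f) (opens_tilde f)).
- by move=> U V VU [x /tilde_inl/VU|y /tilde_inr/VU] ?; [apply/tilde_inl|apply/tilde_inr].
- move=> U I C cov [x /tilde_inl/cov[i _ Ci]|y /tilde_inr/cov[i _ Ci]]; exists i => //.
    exact/tilde_inl.
  exact/tilde_inr.
- move=> U V [x [/tilde_inl Ux /tilde_inl Vx]|y [/tilde_inr Ux /tilde_inr Vx]].
    exact/tilde_inl.
  exact/tilde_inr.
- by move=> U x Ux; apply/tilde_inl.
- move=> W x Wx; exists (cylX W) => // -[x' /tilde_inl //|y /tilde_inr]; exact: cylXY.
Defined.

Definition inr_transfer : transfer Y (cylinder f).
Proof.
apply: (@Transfer Y (cylinder f) (@cinr _ _ f) (opens_inr f)).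
- by move=> U V VU _ [y Vy <-]; exists y => //; exact: VU.
- by move=> U I C cov _ [y /cov[i _ Ci] <-]; exists i => //; exists y.
- by move=> U V [x [/im_inr_inl//]|y [/im_inr Uy /im_inr Vy]]; apply/im_inr.
- by move=> U y Uy; apply/im_inr.
- by move=> W y Wy; exists (cylY W) => // _ [y' Wy' <-].
Defined.

Variables (S : sheaf X) (T : sheaf Y) (eta : shom S (pushforward f T)).

Lemma Zstar_tilde_additive (U : opens X) : zmod_morphism (@Zstar_tilde _ _ _ _ _ eta U).
Proof. by move=> s t; rewrite /Zstar_tilde /= !raddfB. Qed.
HB.instance Definition _ U :=
  GRing.isZmodMorphism.Build _ _ (@Zstar_tilde _ _ _ _ _ eta U) (@Zstar_tilde_additive U).

Lemma Zstar_inr_additive (V : opens Y) : zmod_morphism (@Zstar_inr _ _ _ _ _ eta V).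
Proof. by move=> s t; rewrite /Zstar_inr /= !raddfB. Qed.
HB.instance Definition _ V :=
  GRing.isZmodMorphism.Build _ _ (@Zstar_inr _ _ _ _ _ eta V) (@Zstar_inr_additive V).

Lemma csoft_pull_tilde (CC : set (set X)) :
  csoft CC S -> csoft CC (pull tilde_transfer (Zstar eta)).
Proof.
have h (U V : opens X) (h : V `<=` U) (s : Zstar eta (opens_tilde f U)) :
    Zstar_tilde (res (Zstar eta) (trm_mono tilde_transfer h) s) = res S h (Zstar_tilde s).
  rewrite /Zstar_tilde /=.
  have k : V `<=` cylX (opens_tilde f U) by move=> x /h Ux; apply/tilde_inl.
  by rewrite (res_comp _ _ k) (res_comp _ _ k).
apply: (@csoft_iso _ _ _ _ (@SHom X (pull tilde_transfer (Zstar eta)) S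
  (fun U => @Zstar_tilde _ _ _ _ _ eta U) h)).
by move=> U; exact: Zstar_tilde_bij.
Qed.

Lemma csoft_pull_inr (CC : set (set Y)) :
  csoft CC T -> csoft CC (pull inr_transfer (Zstar eta)).
Proof.
have h (U V : opens Y) (h : V `<=` U) (s : Zstar eta (opens_inr f U)) :
    Zstar_inr (res (Zstar eta) (trm_mono inr_transfer h) s) = res T h (Zstar_inr s).
  rewrite /Zstar_inr /=.
  have k : V `<=` cylY (opens_inr f U) by move=> y /h Uy; apply/im_inr.
  by rewrite (res_comp _ _ k) (res_comp _ _ k).
apply: (@csoft_iso _ _ _ _ (@SHom Y (pull inr_transfer (Zstar eta)) T
  (fun V => @Zstar_inr _ _ _ _ _ eta V) h)).
by move=> V; exact: Zstar_inr_bij.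
Qed.

End CylinderTransfers.

(** At a point of [X] a local preimage [t] of the first component is completed to the pair of [t]
    and [eta t]; the second components then match because [s] is compatible with [eta']. At a point
    of [Y] the neighbourhood misses [X], and the first component is 0. *)
Lemma Zstar_map_exact (X Y : topologicalType) (f : continuousType Y X)
    (S S' S'' : sheaf X) (T T' T'' : sheaf Y)
    (eta : shom S (pushforward f T)) (eta' : shom S' (pushforward f T'))
    (eta'' : shom S'' (pushforward f T''))
    (a : shom S S') (b : shom T T') (ab : forall U s, eta' U (a U s) = b (opre f U) (eta U s))
    (a' : shom S' S'') (b' : shom T' T'')
    (ab' : forall U s, eta'' U (a' U s) = b' (opre f U) (eta' U s)) :
  exact_at a a' -> exact_at b b' -> exact_at (Zstar_map ab) (Zstar_map ab').
Proof.
move=> exa exb W s.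
have aa U t : a' U (a U t) = 0.
  by apply/exa => x Ux; exists U, (@subset_refl _ _), t; rewrite res_id.
have bb U t : b' U (b U t) = 0.
  by apply/exb => x Ux; exists U, (@subset_refl _ _), t; rewrite res_id.
split; last first.
  move=> sloc; apply: section_eq0 => x /sloc[V [h [t [Vx tE]]]].
  exists V, h; split=> //; rewrite -shom_res -tE; apply: val_inj => /=.
  by rewrite aa bb.
move=> /(congr1 \val)/= [as0 bs0] [x|y] Wx.
  have [V [h [t [Vx tE]]]] := (exa _ _).1 as0 x Wx.
  have hW : opens_tilde f V `<=` W.
    by move=> [x' /tilde_inl/h //|y /tilde_inr/h]; exact: cylXY.
  have hX : cylX (opens_tilde f V) `<=` V by move=> z /tilde_inl.
  have hY : cylY (opens_tilde f V) `<=` opre f (cylX (opens_tilde f V)).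
    by move=> y /tilde_inr Vy; apply/tilde_inl.
  pose U := opens_tilde f V.
  have tP : eta (cylX U) (res S hX t) = res T (cylXY U) (res T hY (eta (cylX U) (res S hX t))).
    by rewrite (res_comp _ _ (@subset_refl _ _)) res_id.
  exists U, hW, (@mkeqz _ _ (eta (cylX U) \o fst) (res T (cylXY U) \o snd) (_, _) tP).
  split; first by apply/tilde_inl.
  have aE : a _ (res S hX t) = res S' (cylX_sub hW) (\val s).1.
    by rewrite shom_res tE; exact: res_comp.
  apply: val_inj; apply: (congr2 pair) => //=.
  rewrite shom_res -ab aE shom_res ZsecP.
  have k : opre f (cylX U) `<=` cylY W.
    by move=> z Uz; apply: cylXY; exact: (hW (cinl f (f z)) Uz).
  by rewrite /= (@res_comp _ T' _ _ _ _ _ k); exact: (@res_comp _ T').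
have [V [h [t [Vy tE]]]] := (exb _ _).1 bs0 y Wx.
have hW : opens_inr f V `<=` W by move=> _ [y' /h Wy' <-].
have hY : cylY (opens_inr f V) `<=` V by move=> z /im_inr.
have h0 : cylX (opens_inr f V) `<=` set0 by move=> x /im_inr_inl.
have h0' : opre f (cylX (opens_inr f V)) `<=` set0 by move=> z /h0.
pose U := opens_inr f V.
have tP : eta (cylX U) 0 = res T (cylXY U) (res T hY t).
  exact: (@sec_empty _ T (opre f (cylX U))).
exists U, hW, (@mkeqz _ _ (eta (cylX U) \o fst) (res T (cylXY U) \o snd) (0, _) tP).
split; first by apply/im_inr.
apply: val_inj; apply: (congr2 pair) => /=; first exact: (sec_empty h0).
by rewrite shom_res tE; exact: res_comp.
Qed.

Section TripleResolution.
Variables (X Y : topologicalType) (f : continuousType Y X).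
Variables (S : sheaf X) (T : sheaf Y) (eta : shom S (pushforward f T)).

Variable R : triple_resolution eta.

Lemma Zphi_is_resolution : is_resolution (Zphi R).
Proof.
have [monoK exK0 exK] := tK_resolution R; have [monoL exL0 exL] := tL_resolution R.
split; [|exact: Zstar_map_exact exK0 exL0|move=> q]; last first.
  exact: (Zstar_map_exact (@tphi_diff _ _ _ _ _ _ R q) (@tphi_diff _ _ _ _ _ _ R q.+1)
    (exK q) (exL q)).
move=> W s t /(congr1 \val)/= [/monoK st1 /monoL st2]; apply: val_inj.
by rewrite [LHS]surjective_pairing [RHS]surjective_pairing st1 st2.
Qed.

(** Over all of [Z(f)] the part in [Y] is the preimage of the part in [X], so the second component
    of a pair is determined by the first. *)
Lemma Zphi_glob_bij q : bijective (Zphi_glob R q).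
Proof.
have hX : opensT X `<=` cylX (opensT (cylinder f)) by [].
have bijX := res_bij (tK R q) (cylX_T (f := f)) hX.
have [r rK Kr] := bijX.
have cyl1 : cylY (opensT (cylinder f)) `<=` opre f (cylX (opensT (cylinder f))) by [].
have injY := bij_inj (res_bij (tL R q) (cylXY (opensT (cylinder f))) cyl1).
exists (fun s : gsec (Zphi R q) => r (\val s).1) => [k|s]; first exact: rK.
have E : res (tK R q) (@cylX_T _ _ f) (r (\val s).1) = (\val s).1 := Kr _.
apply: val_inj; rewrite /= [RHS]surjective_pairing; apply: (congr2 pair) => //.
apply: injY; rewrite -ZsecP -[X in tphi R q _ X]E.
exact: esym (Zphi_glob_subproof (r (\val s).1)).
Qed.

Lemma Zphi_compl_bij q : bijective (Zphi_compl R q).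
Proof.
have hY : opensT Y `<=` cylY (cyl_compl f) by move=> y _ [].
have [r rK Kr] := res_bij (tL R q) (cylY_compl (f := f)) hY.
exists (fun s : Zphi R q (cyl_compl f) => r (\val s).2) => [l|s]; first exact: rK.
apply: val_inj; rewrite /= [RHS]surjective_pairing; apply: (congr2 pair).
  exact: (sec_empty (@cylX_compl0 _ _ f)).
exact: Kr.
Qed.

Lemma comapping_cone_to_relcone_bij q :
  bijective (@cohom_map _ _ (comapping_cone_to_relcone R) q).
Proof.
apply: cohom_map_bij_degreewise => {}q.
have [g gK Kg] := Zphi_glob_bij q.
case: q g gK Kg => [|q] g gK Kg; first by exists g.
have [c cK Kc] := Zphi_compl_bij q.
exists (fun p => (g p.1, c p.2)) => -[x y]; apply: (congr2 pair);
  [exact: gK|exact: cK|exact: Kg|exact: Kc].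
Qed.

End TripleResolution.

(** * Maps induced on relative cones by morphisms of resolutions *)

Section RelativeCones.
Variables (X : topologicalType) (A : sheaf X) (W : opens X).
Implicit Types K J I : augcplx A.

Definition augmap_comp K J I (h : augmap J I) (u : augmap K J) : augmap K I :=
  @AugMap X A K I (fun q => shom_comp (h q) (u q))
    (fun U s => etrans (congr1 (h 0 U) (augmap_aug u s)) (augmap_aug h s))
    (fun q U s => etrans (congr1 (h q.+1 U) (augmap_diff u s)) (augmap_diff h _)).

(** The homotopy between [u] and [v] consists of sheaf morphisms, so it commutes with restriction to
    [W] and acts on the cones. *)
Lemma relcone_map_unique K I (u v : augmap K I) q :
  is_resolution K -> (forall q, injective_sheaf (I q)) ->
  @cohom_map _ _ (relcone_map u W) q =1 @cohom_map _ _ (relcone_map v W) q.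
Proof.
move=> resK injI; have [h [h0 hS]] := augmap_homotopy resK injI u v.
apply: (@cone_map_homotopy _ _ _ _ _ _ _ _ _ _
  (@seccplx_map_gres X A K I u W) (@seccplx_map_gres X A K I v W)
  (fun q => h q (opensT X)) (fun q => h q W)
  (h0 _) (fun q => hS q _) (h0 _) (fun q => hS q _)).
by move=> r x; exact: esym (shom_res (h r) (sub_opensT W) x).
Qed.

Lemma relcone_map_comp K J I (h : augmap J I) (u : augmap K J) (v : augmap K I) q :
  is_resolution K -> (forall q, injective_sheaf (I q)) ->
  forall c, @cohom_map _ _ (relcone_map h W) q (@cohom_map _ _ (relcone_map u W) q c) =
            @cohom_map _ _ (relcone_map v W) q c.
Proof.
move=> resK injI c; rewrite -(@relcone_map_unique K I (augmap_comp h u) v q resK injI c).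
by apply: cohom_map_comp; case: (q).
Qed.

Lemma ker_to_cone_natural K J (g : augmap K J) q (x : relcplx K W q) :
  ker_to_cone (gres J W) q (relcplx_map g W q x) =
  relcone_map g W q (ker_to_cone (gres K W) q x).
Proof.
by case: q x => [|q] x //; apply: (congr2 pair erefl); exact: esym (raddf0 _).
Qed.

Lemma relcone_map_bij K J (u : augmap K J) q :
  acyclic (cone (seccplx_map u (opensT X))) -> acyclic (cone (seccplx_map u W)) ->
  bijective (@cohom_map _ _ (relcone_map u W) q).
Proof. by move=> acT acW; apply: acyclic_cone_bij; exact: acyclic_cone_map. Qed.

Lemma relcone_map_flabby_bij (F F' : flabby_resolution A) (u : augmap F F') q :
  bijective (@cohom_map _ _ (relcone_map u W) q).
Proof.
by apply: relcone_map_bij; apply: acyclic_cone_flabby;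
  (exact: flabby_is_resolution || exact: flabby_cplx_flabby).
Qed.

Lemma relcplx_to_relcone_bij (F : flabby_resolution A) q :
  bijective (@cohom_map _ _ (ker_to_cone (gres F W)) q).
Proof. by apply: ker_to_cone_bij => r y; exact: (@flabby_cplx_flabby _ _ F r W y). Qed.

End RelativeCones.

Lemma additive_factor (A B C : zmodType) (u : {additive A -> C}) (w : {additive B -> C}) :
  bijective u -> bijective w ->
  exists2 phi : {additive A -> B}, bijective phi & forall x, w (phi x) = u x.
Proof.
move=> [v uK vK] bij_w; have [r wK rK] := bij_w.
pose phi x := r (u x).
have phiB : zmod_morphism phi.
  by move=> x y; apply: (bij_inj bij_w); rewrite raddfB /phi !rK raddfB.
pose phiA := GRing.isZmodMorphism.Build _ _ phi phiB.
pose phim : {additive A -> B} := HB.pack phi phiA.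
exists phim => [|x]; last exact: rK.
by exists (v \o w) => x; rewrite /= /phi ?rK ?uK ?vK ?wK.
Qed.

Theorem theorem6p16 (X Y : topologicalType) (f : continuousType Y X)
    (pX : paracompact X) (pY : paracompact Y)
    (S : sheaf X) (T : sheaf Y) (eta : shom S (pushforward f T))
    (R : triple_resolution eta)
    (softK : forall q, soft (tK R q)) (softL : forall q, soft (tL R q))
    (F : flabby_resolution (Zstar eta)) (q : nat) :
  exists Phi : {additive cohomology (comapping_cone R) q -> map_cohomology F q},
    bijective Phi /\ is_canonical Phi.
Proof.
pose I := inj_flabby_resolution (Zstar eta); pose W := cyl_compl f.
have injI r : injective_sheaf (I r) by exact: inj_resolution_injective.
have resZ := Zphi_is_resolution R; have resI : is_resolution I := flabby_is_resolution I.
have [theta0] := augmap_exists resZ injI.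
have [g0] := augmap_exists (flabby_is_resolution F) injI.
have flI r : flabby (I r) := @flabby_cplx_flabby _ _ I r.
(* Sections over [Z(f)] and over its open part are global sections on [X] and on [Y]; the whole
   space is closed in itself, so the class of closed sets applies. *)
have bij_theta0 : bijective (@cohom_map _ _ (relcone_map theta0 W) q).
  apply: relcone_map_bij.
    rewrite -opens_tildeT.
    apply: (@acyclic_cone_pull _ _ (tilde_transfer f) closed _ _ _ theta0 (opensT X)) => //.
    - exact: closed_good.
    - by move=> r; apply: csoft_pull_tilde; exact: soft_csoft.
    - by move=> r; apply: (flabby_csoft_closed pX); exact: pull_flabby.
  rewrite /W -opens_inrT.
  apply: (@acyclic_cone_pull _ _ (inr_transfer f) closed _ _ _ theta0 (opensT Y)) => //.
  - exact: closed_good.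
  - by move=> r; apply: csoft_pull_inr; exact: soft_csoft.
  - by move=> r; apply: (flabby_csoft_closed pY); exact: pull_flabby.
have bij_u : bijective (@cohom_map _ _ (relcone_map theta0 W) q \o
    @cohom_map _ _ (comapping_cone_to_relcone R) q).
  exact: bij_comp bij_theta0 (comapping_cone_to_relcone_bij R q).
have bij_w : bijective (@cohom_map _ _ (relcone_map g0 W) q \o
    @cohom_map _ _ (ker_to_cone (gres F W)) q).
  by apply: bij_comp; [exact: relcone_map_flabby_bij|exact: relcplx_to_relcone_bij].
have [Phi bijPhi PhiE] := additive_factor bij_u bij_w.
exists Phi; split=> // F' theta g c.
(* As [h] is bijective on the cohomology of cones, the square can be checked in [I]. There [h] after
   [theta] and [h] after [g] induce the same maps as [theta0] and [g0], and the equation becomes the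
   one that defines [Phi]. *)
have [h] := augmap_exists (flabby_is_resolution F') injI.
apply: (bij_inj (@relcone_map_flabby_bij _ _ W F' I h q)).
rewrite (@relcone_map_comp _ _ W _ _ _ h theta theta0) //.
have -> : cohom_map (ker_to_cone (gres F' W)) (cohom_map (relcplx_map g W) (Phi c)) =
    cohom_map (relcone_map g W) (cohom_map (ker_to_cone (gres F W)) (Phi c)).
  by apply: cohom_map_square => x; exact: ker_to_cone_natural.
rewrite (@relcone_map_comp _ _ W _ _ _ h g g0) //; last exact: flabby_is_resolution.
exact: PhiE.
Qed.
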